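(* Let $G$ be any group with $|G| \geq 3$. Then there exist a simple group $S$ and an injective homomorphism $\varphi : G \to S$ such that for every $p \in \{2, 3, \dots\} \cup \{\infty\}$ there exists an element $z \in S$ of order $p$ such that $S$ is generated by $\varphi(G) \cup \{z\}$.
   Context: An element of order $\infty$ is an element of infinite order. The group $G$ may be of arbitrary (finite or infinite, possibly uncountable) cardinality at least $3$. The group $S$ and the embedding $\varphi$ depend only on $G$, not on $p$. *)

(* Defs.v *)
From HB Require Import structures.
From mathcomp Require Import all_boot.
From mathcomp Require Import boolp classical_sets functions cardinality.
Set Implicit Arguments.
Unset Strict Implicit.
Unset Printing Implicit Defensive.
Local Open Scope classical_set_scope.
Local Open Scope group_scope.

(* [groupType] extends [choiceType], but this is no restriction on the groups
   considered: boolp endows every type with a [choiceType] structure.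
   Subgroups are [Prop]-valued sets, so no decidability of membership is
   assumed. *)
Definition is_subgroup (G : groupType) (H : set G) : Prop :=
  [/\ H 1, (forall x y, H x -> H y -> H (x * y)) & (forall x, H x -> H x^-1)].

Definition is_normal_subgroup (G : groupType) (N : set G) : Prop :=
  is_subgroup N /\ (forall x y, N x -> N (x ^ y)).

Definition is_simple (G : groupType) : Prop :=
  [set: G] <> [set 1] /\
  (forall N : set G, is_normal_subgroup N -> N = [set 1] \/ N = [set: G]).

Definition generated_subgroup (G : groupType) (A : set G) : set G :=
  smallest (@is_subgroup G) A.

(* An element of {0, 1, 2, ...} u {oo} is encoded in [option nat],
   with [None] standing for oo. *)
Definition has_order (G : groupType) (z : G) (p : option nat) : Prop :=
  match p with
  | Some n => [/\ (0 < n)%N, z ^+ n = 1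
                & forall m, (0 < m < n)%N -> z ^+ m <> 1]
  | None => forall m, (0 < m)%N -> z ^+ m <> 1
  end.

Definition at_least_two (p : option nat) : Prop :=
  match p with Some n => (2 <= n)%N | None => True end.

(* Main.v *)
Require Import Defs.
From HB Require Import structures.
From mathcomp Require Import all_boot zify.
From mathcomp Require Import boolp classical_sets functions cardinality.
Set Implicit Arguments.
Unset Strict Implicit.
Unset Printing Implicit Defensive.
Local Open Scope group_scope.

(** The proof constructs one group [P] of bijections of a set, generated by a copy of [G] and
    an element [Y] of infinite order, which contains for every order [p >= 2], including
    infinity, an element [Z] of order [p], and in which
    - the normal closure of every nontrivial element of [G] contains [Y];
    - the normal closure of [Y] contains [G], hence is [P];
    - the normal closure of every nontrivial power of every [Z] contains [Y];
    - the subgroup generated by [G] and any [Z] contains [Y], hence is [P].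
    Let [N] be a normal subgroup of [P] that is maximal among those that avoid [Y]
    ([maximal_normal]). A larger normal subgroup contains [Y], so [P / N] is simple; by the first
    and the third property [G] embeds in [P / N] and every [Z] keeps its order; by the fourth,
    [G] and any [Z] generate [P / N] ([simple_quotient]).

    Each of the four properties is forced by relations between [Y], [Z] and the elements of
    [G], for example [1 = Y^e_0 h Y^e_1 h^-1 Y^e_2 h ...] where the exponents sum up to [1] and
    the alternating product of [h] and [h^-1] has an odd number of factors: if [h] becomes
    trivial, so does [Y], and conversely. The exponents are injective codes of the places where
    they occur. The relators that express [Y] by [G] and [Z] cannot be told apart by exponents,
    since [G] and the group generated by [Z] may be small: they contain a fixed aperiodic
    sequence of two elements of [G] ([pattern_aperiodic]). So no two different places in the
    relators and their inverses agree over a fourteenth of a relator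
    ([relators_small_cancellation]).

    What remains is to realize the relations by bijections such that [G], [Y] and [Z] act
    faithfully, i.e. a small cancellation theorem over the free product of countably many copies
    of a group [B] ([limit_good] and [limit_relator]: the copies of [B] act freely, and relators
    act trivially). It is proved by building the action step by step. Each step starts from a
    partial action, in which every walk that spells [10 K] letters of a relator belongs to a
    closed loop. The missing orbits are grown freely around it, to depth [K] ([grow]). A maximal
    walk along a relator that does not close up climbs to a leaf at both ends, and the small
    cancellation hypothesis recovers the walk from the names of the leaves ([src_inj],
    [tgt_inj], [src_neq_tgt]); hence all these walks can be closed independently by arcs of new
    points ([close]). A walk that crosses an arc shares a long piece with the relator of that
    arc, or of an arc nearby, so that the hypothesis on walks along relators survives
    ([match_mid], [close_closes_up]). In the limit all orbits are complete. *)

(** * Walks through partial actions *)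

Section Walks.
Variable B : groupType.

(** The element [b] of the copy of [B] with index [i] is the letter [(i, b)]. *)
Definition letter := (nat * B)%type.
Definition linv (a : letter) : letter := (a.1, a.2^-1).
Definition word := nat -> letter.
Definition shift (w : word) k : word := fun t => w (k + t)%N.
Definition rev_word (w : word) n : word := fun t => linv (w (n.-1 - t)%N).

(** All partial actions live on one set of names. [Leaf q s i g] is the image, created by step
    [q], of the point [s] under the letter [(i, g)]. [Bridge q w x n j g] is created by step [q]
    on the arc that closes the walk of [n] letters of [w] from [x]: it belongs to the orbit of
    the [j]-th letter of that arc. Names that a step does not use stay fixed by everything. *)
Inductive point :=
  | Root
  | Leaf of nat & point & nat & B
  | Bridge of nat & word & point & nat & nat & B.

Definition block (u : point) :=
  match u with Root => 0%N | Leaf q _ _ _ => q.+1 | Bridge q _ _ _ _ _ => q.+1 end.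

(** [op S i u] says that the copy [i] of [B] moves the point [u]. *)
Record structure := Structure {
  op : nat -> point -> Prop;
  act : nat -> B -> point -> point }.

(** The points that a copy of [B] fixes are those where it can still receive a free orbit. *)
Record good (S : structure) : Prop := Good {
  act1 : forall i u, act S i 1 u = u;
  actM : forall i b c u, act S i (b * c) u = act S i b (act S i c u);
  act_free : forall i b u, op S i u -> act S i b u = u -> b = 1;
  act_closed : forall i b u, ~ op S i u -> act S i b u = u }.

Section InStructure.
Variables (S : structure) (gS : good S).

Lemma actK i b u : act S i b^-1 (act S i b u) = u.
Proof. by rewrite -actM // mulVg act1. Qed.

Lemma actVK i b u : act S i b (act S i b^-1 u) = u.
Proof. by rewrite -actM // mulgV act1. Qed.

Lemma act_inj i b : injective (act S i b).
Proof. exact: can_inj (actK i b). Qed.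

Lemma op_act i b u : op S i (act S i b u) <-> op S i u.
Proof.
have [ou|cu] := pselect (op S i u); last by rewrite act_closed.
split=> // _; apply: contrapT => cv.
by apply: (cv); rewrite -(act_closed gS b^-1 cv) actK.
Qed.

Fixpoint pos (w : word) u n :=
  if n is n'.+1 then act S (w n').1 (w n').2 (pos w u n') else u.

Lemma posS w u n : pos w u n.+1 = act S (w n).1 (w n).2 (pos w u n).
Proof. by []. Qed.

Definition walk (w : word) u n :=
  forall t, (t < n)%N -> op S (w t).1 (pos w u t).

Lemma posD w u m n : pos w u (m + n) = pos (shift w m) (pos w u m) n.
Proof. by elim: n => [|n IH]; rewrite ?addn0 // addnS /= IH. Qed.

Lemma eq_pos w w' u n :
  (forall t, (t < n)%N -> w t = w' t) -> pos w u n = pos w' u n.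
Proof.
elim: n => [//|n IH] e /=.
by rewrite e // IH // => t lt; apply: e; lia.
Qed.

Lemma walk_leq w u m n : (m <= n)%N -> walk w u n -> walk w u m.
Proof. by move=> le p t lt; apply: p; lia. Qed.

Lemma walk_shift w u m n : walk w u (m + n) -> walk (shift w m) (pos w u m) n.
Proof. by move=> p t lt; rewrite -posD; apply: p; lia. Qed.

Lemma walk_cat w u m n :
  walk w u m -> walk (shift w m) (pos w u m) n -> walk w u (m + n).
Proof.
move=> p p' t lt; have [/p //|le] := ltnP t m.
have -> : t = (m + (t - m))%N by lia.
by rewrite posD; apply: p'; lia.
Qed.

Lemma pos_inj w n : injective (fun u => pos w u n).
Proof. by elim: n => [//|n IH] u v /= /act_inj /IH. Qed.

Lemma pos_rev w u n t : (t <= n)%N ->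
  pos (rev_word w n) (pos w u n) t = pos w u (n - t).
Proof.
elim: t => [|t IH] le; first by rewrite subn0.
rewrite /= IH; last by lia.
have -> : (n - t = (n.-1 - t).+1)%N by lia.
by rewrite /rev_word /= actK; congr pos; lia.
Qed.

Lemma walk_rev w u n : walk w u n -> walk (rev_word w n) (pos w u n) n.
Proof.
move=> p t lt; rewrite pos_rev; last by lia.
have -> : (n - t = (n.-1 - t).+1)%N by lia.
by apply/op_act; apply: p; lia.
Qed.

Definition loop L w u := walk w u L /\ pos w u L = u.

Definition periodic L (w : word) := forall n, w (L + n)%N = w n.

Lemma shift_periodic L w : periodic L w -> shift w L = w.
Proof. by move=> pw; apply/funext => n; exact: pw. Qed.

Lemma loop_pos L w u n : periodic L w -> loop L w u ->
  pos w u (L + n) = pos w u n.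
Proof. by move=> pw [_ e]; rewrite posD e shift_periodic. Qed.

Lemma loop_walk L w u n : (0 < L)%N -> periodic L w -> loop L w u -> walk w u n.
Proof.
move=> L0 pw [p e]; elim/ltn_ind: n => n IH t lt.
have [/p //|le] := ltnP t L.
have -> : t = (L + (t - L))%N by lia.
by rewrite loop_pos // pw; apply: (IH (t - L).+1); lia.
Qed.

Lemma loop_shift L w u k : (0 < L)%N -> periodic L w -> loop L w u ->
  loop L (shift w k) (pos w u k).
Proof.
move=> L0 pw lp; split; first by apply: walk_shift; apply: loop_walk lp.
by rewrite -posD addnC loop_pos.
Qed.

(** Walks are injective in their starting point: a loop at a later point closes up at the
    start. *)
Lemma loop_unshift L w u k : periodic L w -> walk w u k ->
  loop L (shift w k) (pos w u k) -> loop L w u.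
Proof.
move=> pw p [p' e]; split; first by apply: walk_leq (walk_cat p p'); lia.
apply: (@pos_inj w k); rewrite /= -{1}(shift_periodic pw) -posD addnC.
by rewrite posD.
Qed.

End InStructure.

Lemma pos_extends S S' w u n :
  (forall i u b, op S i u -> act S' i b u = act S i b u) ->
  walk S w u n -> forall t, (t <= n)%N -> pos S' w u t = pos S w u t.
Proof.
move=> eA p; elim=> [//|t IH] lt /=.
by rewrite IH 1?ltnW // eA //; apply: p.
Qed.

Definition extends S S' := (forall i u, op S i u -> op S' i u) /\
  (forall i u b, op S i u -> act S' i b u = act S i b u).

Lemma walk_extends S S' w u n : extends S S' -> walk S w u n -> walk S' w u n.
Proof.
move=> [eo ea] p t lt; rewrite (pos_extends ea p) 1?ltnW //.
exact/eo/p.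
Qed.

Lemma loop_extends S S' L w u : extends S S' -> loop S L w u -> loop S' L w u.
Proof.
move=> e [p eu]; split; first exact: walk_extends e p.
by rewrite (pos_extends e.2 p).
Qed.

Lemma extends_trans S1 S2 S3 : extends S1 S2 -> extends S2 S3 -> extends S1 S3.
Proof.
move=> [o a] [o' a']; split=> [i u /o /o' //|i u b ou].
by rewrite a' ?a //; exact: o.
Qed.

Lemma walk_restrict S S' w u n : extends S S' ->
  (forall t, (t < n)%N -> op S (w t).1 (pos S' w u t)) -> walk S w u n.
Proof.
move=> e o; have eq t : (t <= n)%N -> pos S w u t = pos S' w u t.
  elim: t => [//|t IH] lt; rewrite !posS IH 1?ltnW // e.2 //.
  exact: o.
by move=> t lt; rewrite eq 1?ltnW //; apply: o.
Qed.

Definition reduced (w : word) n :=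
  (forall t, (t < n)%N -> (w t).2 != 1) /\
  (forall t, (t.+1 < n)%N -> (w t).1 != (w t.+1).1).

Lemma reduced_shift w m n : reduced w (m + n) -> reduced (shift w m) n.
Proof.
move=> [r1 r2]; split=> t lt; rewrite /shift; first by apply: r1; lia.
by rewrite addnS; apply: r2; lia.
Qed.

Lemma reduced_leq w m n : (m <= n)%N -> reduced w n -> reduced w m.
Proof. by move=> le [r1 r2]; split=> t lt; [apply: r1|apply: r2]; lia. Qed.

Lemma reduced_rev w n : reduced w n -> reduced (rev_word w n) n.
Proof.
move=> [r1 r2]; split=> t lt; rewrite /rev_word /=.
  by rewrite invg_eq1; apply: r1; lia.
have -> : (n.-1 - t = (n.-1 - t.+1).+1)%N by lia.
by rewrite eq_sym; apply: r2; lia.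
Qed.

(** * Adding free orbits to a partial action *)

(** New orbits are given by charts [chart o : B -> point], on which the copy [ix o] acts by left
    translation of the parameter. They have to be disjoint for each copy, and to avoid the
    points that this copy moves already. *)
Section Extension.
Variables (S : structure) (gS : good S).
Variables (O : Type) (V : O -> Prop) (ix : O -> nat) (chart : O -> B -> point).
Hypothesis chart_inj : forall o o' g g', V o -> V o' -> ix o = ix o' ->
  chart o g = chart o' g' -> o = o' /\ g = g'.
Hypothesis chart_closed : forall o g, V o -> ~ op S (ix o) (chart o g).

Definition in_orbit i u (og : O * B) :=
  [/\ V og.1, ix og.1 = i & chart og.1 og.2 = u].

Definition ext_op i u := op S i u \/ exists og, in_orbit i u og.

Definition ext_act i b u :=
  if pselect (op S i u) then act S i b u
  else if pselect (exists og, in_orbit i u og) is left e then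
    let og := projT1 (cid e) in chart og.1 (b * og.2)
  else u.

Definition ext := Structure ext_op ext_act.

Lemma ext_actO i b u : op S i u -> ext_act i b u = act S i b u.
Proof. by rewrite /ext_act; case: pselect. Qed.

Lemma ext_actV o b g : V o -> ext_act (ix o) b (chart o g) = chart o (b * g).
Proof.
move=> Vo; rewrite /ext_act.
destruct (pselect (op S (ix o) (chart o g))) as [ou|nu]; first by case: (chart_closed Vo ou).
destruct (pselect (exists og, in_orbit (ix o) (chart o g) og)) as [e|n].
  2: by case: n; exists (o, g).
case: (cid e) => -[o' g'] /= [/= V' e' e2].
by have [-> ->] := chart_inj V' Vo e' e2.
Qed.

Lemma ext_actC i b u : ~ ext_op i u -> ext_act i b u = u.
Proof.
move=> n; rewrite /ext_act.
destruct (pselect (op S i u)) as [o|no]; first by case: n; left.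
by destruct (pselect (exists og, in_orbit i u og)) as [e|ne] => //; case: n; right.
Qed.

Lemma ext_good : good ext.
Proof.
split=> [i u|i b c u|i b u|i b u] /=; last exact: ext_actC.
- case: (pselect (ext_op i u)) => [[o|[[o g] [/= Vo <- <-]]]|n].
  + by rewrite ext_actO // act1.
  + by rewrite ext_actV // mul1g.
  + by rewrite ext_actC.
- case: (pselect (ext_op i u)) => [[o|[[o g] [/= Vo <- <-]]]|n].
  + by rewrite !ext_actO ?actM //; apply/op_act.
  + by rewrite !ext_actV // mulgA.
  + by rewrite !ext_actC.
- move=> [o|[[o g] [/= Vo <- <-]]].
  + by rewrite ext_actO //; apply: act_free.
  + rewrite ext_actV // => /chart_inj [] // _ e.
    by apply: (mulIg g); rewrite /= e mul1g.
Qed.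

Lemma ext_extends : extends S ext.
Proof. by split=> [i u o|i u b o] /=; [left|rewrite ext_actO]. Qed.

End Extension.
End Walks.

(** * Growing leaves *)

Definition fresh (B : groupType) q (S : structure B) :=
  forall i u, (q < block u)%N -> ~ op S i u.

Section Grow.
Variables (B : groupType) (K q : nat) (X : structure B).
Hypotheses (K0 : (0 < K)%N) (gX : good X) (fX : fresh q X).

(** [sprouts s i k]: the copy [i] of [B] receives a new orbit at the point [s], of depth [k]. A
    leaf sprouts only in the directions other than the one it came from, and up to depth [K]. *)
Inductive sprouts : point B -> nat -> nat -> Prop :=
  | Sprouts0 s i : (block s <= q)%N -> ~ op X i s -> sprouts s i 0
  | SproutsS s i k g j : sprouts s i k -> g != 1 -> j <> i -> (k.+1 < K)%N ->
      sprouts (Leaf q s i g) j k.+1.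

Definition sprout (o : point B * nat) g := if g == 1 then o.1 else Leaf q o.1 o.2 g.

Definition sprouting (o : point B * nat) := exists k, sprouts o.1 o.2 k.

Definition grow := ext X sprouting snd sprout.

Fixpoint depth (u : point B) :=
  if u is Leaf p s _ _ then if p == q then (depth s).+1 else 0%N else 0%N.

Lemma depth_old u : (block u <= q)%N -> depth u = 0%N.
Proof. by case: u => //= p s i g lt; case: eqP => // e; lia. Qed.

Lemma sprouts_depth s i k : sprouts s i k -> depth s = k.
Proof.
elim=> [s' i' /depth_old // | s' i' k' g j _ IH _ _ _] /=.
by rewrite eqxx IH.
Qed.

Lemma sprouts_ltK s i k : sprouts s i k -> (k < K)%N.
Proof. by case. Qed.

Lemma sprouts_self s i g j k : sprouts (Leaf q s i g) j k ->
  exists k', [/\ sprouts s i k', g != 1, j <> i & k = k'.+1].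
Proof.
move E: (Leaf q s i g) => u sp; case: sp E => [s' i' le _ e|s' i' k' g' j' sp g1 ne lt [-> -> ->]].
  by move: le; rewrite -e /=; lia.
by exists k'; split.
Qed.

Lemma sprouts_closed s i k : sprouts s i k -> ~ op X i s.
Proof. by case=> // *; apply: fX => /=. Qed.

Lemma sprout_inj o o' g g' :
  sprouting o -> sprouting o' ->
  o.2 = o'.2 -> sprout o g = sprout o' g' -> o = o' /\ g = g'.
Proof.
case: o o' => [s i] [s' i'] [k /= sp] [k' /= sp'] e; rewrite -{}e in sp' *.
rewrite /sprout /=; case: (g =P 1) => [->|_]; case: (g' =P 1) => [->|_] e.
- by rewrite e.
- by rewrite e in sp; have [? [_ _ /(_ erefl)]] := sprouts_self sp.
- by rewrite -e in sp'; have [? [_ _ /(_ erefl)]] := sprouts_self sp'.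
- by case: e => -> ->.
Qed.

Lemma sprout_closed o g : sprouting o ->
  ~ op X o.2 (sprout o g).
Proof.
case: o => s i [k /= sp]; rewrite /sprout; case: eqP => [_|_] /=.
  exact: sprouts_closed sp.
by apply: fX => /=.
Qed.

Lemma grow_good : good grow.
Proof. by apply: ext_good; [exact: gX|exact: sprout_inj|exact: sprout_closed]. Qed.

Lemma grow_extends : extends X grow.
Proof. exact: ext_extends. Qed.

Lemma old_block i u : op X i u -> (block u <= q)%N.
Proof. by rewrite leqNgt => o; apply/negP => /fX /(_ o). Qed.

Lemma grow_opens i u : (block u <= q)%N -> op grow i u.
Proof.
move=> le; have [o|c] := pselect (op X i u); first by left.
by right; exists ((u, i), 1); split=> /=; rewrite ?/sprout ?eqxx //; exists 0%N; constructor.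
Qed.

Lemma sprouts_block s i k : sprouts s i k -> (block s <= q.+1)%N.
Proof. by case=> //= *; lia. Qed.

Lemma grow_fresh : fresh q.+1 grow.
Proof.
move=> i u lt [/old_block|[[[s j] g] [[k /= sp] _ e]]]; first by lia.
have := sprouts_block sp; move: lt; rewrite -e /sprout.
by case: (g =P 1) => _ /=; lia.
Qed.

Definition leaf_of i u := exists s g k, [/\ u = Leaf q s i g, g != 1 & sprouts s i k].

Lemma leaf_of_depth i u : leaf_of i u -> (0 < depth u <= K)%N.
Proof.
move=> [s [g [k [-> _ sp]]]] /=; rewrite eqxx (sprouts_depth sp).
exact: sprouts_ltK sp.
Qed.

Lemma leaf_of_next i u j g : leaf_of i u -> op grow j u -> j != i -> g != 1 ->
  act grow j g u = Leaf q u j g /\ leaf_of j (act grow j g u).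
Proof.
move=> [s [h [k [-> h1 sp]]]] [/old_block /=|]; first by lia.
move=> [[[s' j'] h'] [[k' /= sp'] /= <-]].
rewrite /sprout /=; case: eqP => [h'1|_] e ji g1; last first.
  by case: e ji => _ ->; rewrite eqxx.
have := ext_actV sprout_inj sprout_closed g 1 (ex_intro _ k' sp' : sprouting (s', j')).
rewrite /sprout eqxx /= mulg1 (negPf g1) -e => ->; split=> //.
by exists s', g, k'; split=> //; rewrite e.
Qed.

Lemma grow_step i g u : op grow i u -> g != 1 ->
  [\/ op X i u, leaf_of i u | leaf_of i (act grow i g u)].
Proof.
move=> [o|[[o h] [/= V <- <-]]] g1; first by constructor 1.
have [k sp] := V.
case h1: (h == 1); last first.
  constructor 2; exists o.1, h, k.
  by split; rewrite /sprout ?h1.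
constructor 3; rewrite (ext_actV sprout_inj sprout_closed) // (eqP h1) mulg1.
by exists o.1, g, k; rewrite /sprout (negPf g1).
Qed.

Lemma grow_depth_step i g u : op grow i u ->
  (depth (act grow i g u) <= depth u)%N \/
  act grow i g u = Leaf q u i g /\ depth (act grow i g u) = (depth u).+1.
Proof.
move=> [o|[[o h] [/= V <- <-]]].
  left; rewrite (grow_extends.2 _ _ _ o) depth_old //.
  by apply: (@old_block i); apply/op_act.
rewrite (ext_actV sprout_inj sprout_closed) // /sprout.
case: (h =P 1) => [->|_]; last first.
  by left; case: eqP => _ //=; rewrite eqxx //; lia.
rewrite mulg1; case: eqP => _; first by left.
by right; rewrite /= eqxx.
Qed.

(** Growth stops only at depth [K]. *)
Lemma grow_depth_closed i j u : op grow i u -> ~ op grow j u -> (K <= depth u)%N.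
Proof.
move=> oi cj; have [le|lt] := leqP (block u) q; first by case: cj; apply: grow_opens.
have open s k : sprouts s j k -> op grow j s.
  by move=> sp; right; exists ((s, j), 1); split=> //=; [exists k|rewrite /sprout eqxx].
case: oi => [/old_block|[[[s i'] h] [[k /= sp] _]]]; first by lia.
rewrite /sprout /=; case: eqP => [_ e|/eqP h1 e].
  rewrite -{}e in cj lt *; case: sp lt cj => [s' i'' le _|s' i'' k' g j' sp g1 ne ltk] /=.
    by lia.
  move=> _ cj; case: cj; have [->|/eqP ne'] := eqVneq j i''.
    right; exists ((s', i''), g); split=> //=; first by exists k'.
    by rewrite /sprout /= (negPf g1).
  by apply: (@open _ k'.+1); constructor.
rewrite -{}e in cj *.
rewrite leqNgt /= eqxx (sprouts_depth sp); apply/negP => lt'; apply: cj.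
have [->|/eqP ne] := eqVneq j i'.
  right; exists ((s, i'), h); split=> //=; first by exists k.
  by rewrite /sprout /= (negPf h1).
by apply: (@open _ k.+1); constructor.
Qed.

(** Having entered a leaf, a reduced walk can only climb, hence for less than [K] steps. *)
Lemma climb w u n i : leaf_of i u -> walk grow w u n -> reduced w n ->
  (w 0%N).1 != i \/ n = 0%N -> (n + depth u <= K)%N.
Proof.
elim: n w u i => [|n IH] w u i a p r c; first by case/andP: (leaf_of_depth a).
case: c => [c|//].
have [e a'] := leaf_of_next a (p 0%N erefl) c (r.1 0%N erefl).
have := IH (shift w 1) _ _ a' (@walk_shift _ grow w u 1 n p) (@reduced_shift _ w 1 n r).
rewrite [X in depth X]e /= eqxx addSnnS; apply.
by case: n {IH} p r => [|n] p [_ r]; [right|left; rewrite eq_sym; apply: (r 0%N)].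
Qed.

(** After a step onto a leaf fewer than [K] letters follow, by [climb]; by reversal, fewer than
    [K] letters precede a step that leaves a leaf. *)
Lemma middle_old w u n t : walk grow w u n -> reduced w n ->
  (K <= t)%N -> (t + K < n)%N -> op X (w t).1 (pos grow w u t).
Proof.
move=> p r le lt; have tn : (t < n)%N by lia.
have gg := grow_good.
case: (grow_step (p t tn) (r.1 t tn)) => [//|a|a].
- have p' : walk grow (rev_word w t) (pos grow w u t) t.
    by apply: (walk_rev gg); apply: walk_leq p; lia.
  have r' : reduced (rev_word w t) t by apply: reduced_rev; apply: reduced_leq r; lia.
  have := climb a p' r'; have := leaf_of_depth a.
  case: t {p' r' a} le lt tn => [|t] le lt tn; first by lia.
  move=> d c; suff: (t.+1 + depth (pos grow w u t.+1) <= K)%N by lia.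
  by apply: c; left; rewrite /rev_word /= subn0; apply: r.2.
- have en : n = (t.+1 + (n - t.+1))%N by lia.
  have p' : walk grow (shift w t.+1) (pos grow w u t.+1) (n - t.+1).
    by apply: walk_shift; rewrite -en.
  have r' : reduced (shift w t.+1) (n - t.+1) by apply: reduced_shift; rewrite -en.
  have := climb a p' r'; have := leaf_of_depth a.
  move=> d c; rewrite -[act _ _ _ _]/(pos grow w u t.+1) in d c.
  suff: (n - t.+1 + depth (pos grow w u t.+1) <= K)%N by lia.
  by apply: c; left; rewrite /shift addn0 eq_sym; apply: r.2; lia.
Qed.

Definition parent (u : point B) := if u is Leaf _ s _ _ then s else u.
Definition label (u : point B) : letter B := if u is Leaf _ _ i g then (i, g) else (0%N, 1).

(** A walk that ends at depth [K] and is old [K] steps earlier gains at most one level per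
    step, so that each of its last [K] steps climbs; the names of the points it reaches
    record the letters of these steps. *)
Lemma summit_end w u n t : walk grow w u n -> reduced w n -> (K.*2 < n)%N ->
  (K <= depth (pos grow w u n))%N -> (t < K)%N ->
  label (iter t parent (pos grow w u n)) = w (n.-1 - t)%N.
Proof.
move=> p r ltn dK.
have d0 : depth (pos grow w u (n - K)) = 0%N.
  have -> : (n - K = (n - K.+1).+1)%N by lia.
  have o : op X (w (n - K.+1)%N).1 (pos grow w u (n - K.+1)).
    by apply: middle_old p r _ _; lia.
  rewrite posS (grow_extends.2 _ _ _ o) depth_old //.
  by apply: (@old_block (w (n - K.+1)%N).1); apply/op_act.
have up s : (s < n)%N -> (depth (pos grow w u s.+1) <= depth (pos grow w u s))%N \/
    pos grow w u s.+1 = Leaf q (pos grow w u s) (w s).1 (w s).2 /\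
    depth (pos grow w u s.+1) = (depth (pos grow w u s)).+1.
  by move=> sn; exact: grow_depth_step (p s sn).
have le s : (s <= K)%N -> (depth (pos grow w u (n - K + s)) <= s)%N.
  elim: s => [|s IH] ls; first by rewrite addn0 d0.
  rewrite addnS; have ls' : (s <= K)%N by lia.
  by have := IH ls'; case: (up (n - K + s)%N ltac:(lia)) => [|[_]]; lia.
have ge k : (k <= K)%N -> (K <= depth (pos grow w u (n - k)) + k)%N.
  elim: k => [|k IH] lt'; first by rewrite subn0 addn0.
  have lt'' : (k <= K)%N by lia.
  have e : (n - k = (n - k.+1).+1)%N by lia.
  have := IH lt''; rewrite e.
  by case: (up (n - k.+1)%N ltac:(lia)) => [|[_]]; lia.
have step k : (k < K)%N -> pos grow w u (n - k) =
    Leaf q (pos grow w u (n - k.+1)) (w (n.-1 - k)%N).1 (w (n.-1 - k)%N).2.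
  move=> lt'; have e : (n - k = (n - k.+1).+1)%N by lia.
  have <- : (n - k.+1 = n.-1 - k)%N by lia.
  rewrite e; case: (up (n - k.+1)%N ltac:(lia)) => [h|[//]].
  have := ge k (ltnW lt'); have /le : (K - k.+1 <= K)%N by lia.
  have -> : (n - K + (K - k.+1) = n - k.+1)%N by lia.
  by rewrite e; lia.
have it k : (k <= K)%N -> iter k parent (pos grow w u n) = pos grow w u (n - k).
  elim: k => [|k IH] lt'; first by rewrite subn0.
  by rewrite iterS (IH (ltnW lt')) (step k lt').
by move=> lt; rewrite it 1?ltnW // (step t lt) /=; case: (w _).
Qed.

Lemma summit_start w u n t : walk grow w u n -> reduced w n -> (K.*2 < n)%N ->
  (K <= depth u)%N -> (t < K)%N ->
  label (iter t parent u) = linv (w t).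
Proof.
move=> p r ln d lt.
have gg := grow_good.
have := summit_end (walk_rev gg p) (reduced_rev r) ln.
rewrite pos_rev // subnn /= => /(_ t d lt) ->.
by rewrite /rev_word; congr (linv (w _)); lia.
Qed.

End Grow.

Arguments grow : simpl never.

(** * Closing relators *)

(** The metric condition of small cancellation over a free product, for relators of one length
    [L], written as periodic words. The set of relators is closed under the choice of another
    starting letter, so the last two fields speak of all words of [K] letters in relators: such
    a word determines the relator and its place there, and it does not occur in the inverse of a
    relator. *)
Record small_cancellation (B : groupType) K L (R : word B -> Prop) : Prop :=
  SmallCancellation {
  sc_size : (6 <= K)%N /\ (14 * K <= L)%N;
  sc_periodic : forall w, R w -> periodic L w;
  sc_neq1 : forall w n, R w -> (w n).2 != 1;
  sc_alt : forall w n, R w -> (w n).1 != (w n.+1).1;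
  sc_shift : forall w k, R w -> R (shift w k);
  sc_piece : forall w w', R w -> R w' ->
    (forall t, (t < K)%N -> w t = w' t) -> w = w';
  sc_inv_piece : forall w w', R w -> R w' ->
    ~ (forall t, (t < K)%N -> w' t = linv (w (K.-1 - t)%N)) }.

Section Close.
Variables (B : groupType) (K L : nat) (R : word B -> Prop).
Hypothesis sc : small_cancellation K L R.

Lemma sc_reduced w n : R w -> reduced w n.
Proof. by move=> Rw; split=> t _; [exact: (sc_neq1 sc t Rw)|exact: (sc_alt sc t Rw)]. Qed.

(** The invariant of the construction. The length [10 * K] is such that one of the two halves of
    a walk, on either side of a given step, has the [5 * K] letters required by [match_mid]. *)
Definition closes_up S := forall w u, R w -> walk S w u (10 * K) -> loop S L w u.

Variables (q : nat) (X : structure B).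
Hypotheses (gX : good X) (fX : fresh q X) (cX : closes_up X).

Let K6 : (6 <= K)%N. Proof. by case: (sc_size sc). Qed.
Let L14 : (14 * K <= L)%N. Proof. by case: (sc_size sc). Qed.
Let K0 : (0 < K)%N. Proof. by lia. Qed.
Let L0 : (0 < L)%N. Proof. by lia. Qed.

Local Notation Z := (grow K q X).

Let gZ : good Z. Proof. exact: grow_good. Qed.

(** Growing adds at most [K] letters at each end of a walk along a relator. *)
Lemma long_loop w u : R w -> walk Z w u (12 * K) -> loop Z L w u.
Proof.
move=> Rw p; have pK : walk Z w u K by apply: walk_leq p; lia.
apply: (loop_unshift gZ (sc_periodic sc Rw) pK).
apply: (loop_extends (grow_extends K q X)); apply: cX; first exact: (sc_shift sc).
apply: (walk_restrict (grow_extends K q X)) => t lt.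
rewrite -posD; apply: (middle_old K0 gX fX p); [exact: (sc_reduced _ Rw)|lia|lia].
Qed.

Record arc := Arc { aword : word B; asrc : point B; alen : nat }.

Definition tgt a := pos Z (aword a) (asrc a) (alen a).

(** A maximal walk along a relator that does not close up. *)
Record pending a : Prop := Pending {
  pending_rel : R (aword a);
  pending_walk : walk Z (aword a) (asrc a) (alen a);
  pending_ge : (10 * K <= alen a)%N;
  pending_tgt : ~ op Z (aword a (alen a)).1 (tgt a);
  pending_src : ~ op Z (aword a L.-1).1 (asrc a) }.

Lemma pending_lt a : pending a -> (alen a < 12 * K)%N.
Proof.
case=> Rw p ge c _; rewrite ltnNge; apply/negP => le; apply: c.
have p' : walk Z (aword a) (asrc a) (12 * K) by apply: walk_leq p.
by apply: (loop_walk L0 (sc_periodic sc Rw) (long_loop Rw p') (n := (alen a).+1)).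
Qed.

(** Extend the walk in both directions; by [long_loop] this has to stop. *)
Lemma pending_extension w u n : R w -> walk Z w u n -> (10 * K <= n)%N ->
  ~ loop Z L w u ->
  exists a k, [/\ pending a, u = pos Z (aword a) (asrc a) k,
    w = shift (aword a) k & (k + n <= alen a)%N].
Proof.
elim: {n}(12 * K - n)%N {-2}n w u (erefl (12 * K - n)%N) => [|d IH] n w u e Rw p ge nl.
  by case: nl; apply: long_loop => //; apply: walk_leq p; lia.
have [o|c] := pselect (op Z (w n).1 (pos Z w u n)).
  have p' : walk Z w u n.+1.
    by move=> t; rewrite ltnS leq_eqVlt => /predU1P[->|/p].
  have [a [k [pa eu ew le]]] := IH n.+1 w u ltac:(lia) Rw p' ltac:(lia) nl.
  by exists a, k; split=> //; lia.
(* The letter before the first one of the periodic word [w] is [w L.-1]. *)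
have [o|c'] := pselect (op Z (w L.-1).1 u); last first.
  by exists (Arc w u n), 0%N; split=> //; apply: Pending.
set v := act Z (w L.-1).1 (w L.-1).2^-1 u; set w' := shift w L.-1.
have w0 : w' 0%N = w L.-1 by rewrite /w' /shift addn0.
have sw : shift w' 1 = w.
  apply/funext => t; rewrite /w' /shift addnA addn1 prednK //.
  exact: (sc_periodic sc Rw).
have pv : pos Z w' v 1 = u by rewrite posS w0; exact: actVK.
have p1 : walk Z w' v 1.
  by move=> [|//] _; rewrite w0; apply/(op_act gZ).
have p' : walk Z w' v n.+1.
  by rewrite -add1n; apply: walk_cat p1 _; rewrite sw pv.
have Rw' : R w' by exact: (sc_shift sc).
have nl' : ~ loop Z L w' v.
  move=> l; apply: nl; rewrite -sw -pv; apply: loop_shift => //.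
  exact: (sc_periodic sc Rw').
have [a [k [pa ev ew le]]] := IH n.+1 w' v ltac:(lia) Rw' p' ltac:(lia) nl'.
clearbody v w'; exists a, k.+1; split=> //; last by lia.
  by rewrite -pv ev -[k.+1]addn1 posD ew.
by rewrite -sw ew; apply/funext => t; rewrite /shift addnA addn1.
Qed.

Lemma tgt_depth a : pending a -> (K <= depth q (tgt a))%N.
Proof.
move=> [Rw p ge c _]; apply: (grow_depth_closed K0 fX (i := (aword a (alen a).-1).1) _ c).
rewrite /tgt -{2}[alen a]prednK ?posS; last by lia.
by apply/op_act => //; apply: p; lia.
Qed.

Lemma src_depth a : pending a -> (K <= depth q (asrc a))%N.
Proof.
move=> [Rw p ge _ c]; apply: (grow_depth_closed K0 fX (i := (aword a 0%N).1) _ c).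
by apply: (p 0%N); lia.
Qed.

Lemma tgt_label a t : pending a -> (t < K)%N ->
  label (iter t (@parent B) (tgt a)) = aword a ((alen a).-1 - t)%N.
Proof.
move=> pa lt; have [Rw p ge _ _] := pa.
apply: (summit_end K0 gX fX) (p) _ _ _ lt; [exact: (sc_reduced _ Rw)|by lia|].
exact: tgt_depth.
Qed.

Lemma src_label a t : pending a -> (t < K)%N ->
  label (iter t (@parent B) (asrc a)) = linv (aword a t).
Proof.
move=> pa lt; have [Rw p ge _ _] := pa.
apply: (summit_start K0 gX fX p) _ _ _ lt; [exact: (sc_reduced _ Rw)|by lia|].
exact: src_depth.
Qed.

Lemma linvK : involutive (@linv B).
Proof. by move=> [i b]; rewrite /linv invgK. Qed.

Lemma linv_inj : injective (@linv B).
Proof. exact: inv_inj linvK. Qed.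

Lemma pending_len_le a a' : pending a -> pending a' ->
  aword a = aword a' -> asrc a = asrc a' -> (alen a <= alen a')%N.
Proof.
move=> [_ p _ _ _] [_ _ _ c' _] ew es; rewrite leqNgt; apply/negP => lt.
by apply: c'; rewrite /tgt -ew -es; apply: p.
Qed.

(** The leaf where a pending walk starts records its first [K] letters, which determine the
    relator; the walk ends where the relator cannot be followed any longer. *)
Lemma src_inj a a' : pending a -> pending a' -> asrc a = asrc a' -> a = a'.
Proof.
move=> pa pa' es.
have ew : aword a = aword a'.
  apply: (sc_piece sc); [exact: pending_rel|exact: pending_rel|move=> t lt].
  by apply: linv_inj; rewrite -src_label // es src_label.
have en : alen a = alen a'.
  by apply/eqP; rewrite eqn_leq !pending_len_le.
by case: a a' ew en es {pa pa'} => [w x n] [w' x' n'] /= -> -> ->.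
Qed.

(** The leaf where a pending walk ends records its last [K] letters. So two such walks to the
    same point follow the same relator backwards, until both are stuck. *)
Lemma tgt_inj_le a a' : pending a -> pending a' -> tgt a = tgt a' ->
  (alen a <= alen a')%N -> a = a'.
Proof.
move=> pa pa' et le.
have [Rw p ge _ c] := pa; have [Rw' p' ge' _ _] := pa'.
have ew : shift (aword a) (alen a - K) = shift (aword a') (alen a' - K).
  apply: (sc_piece sc); [exact: (sc_shift sc)|exact: (sc_shift sc)|move=> t lt].
  have lt' : (K.-1 - t < K)%N by lia.
  have := tgt_label pa lt'; rewrite et tgt_label //.
  have -> : ((alen a).-1 - (K.-1 - t) = alen a - K + t)%N by lia.
  have -> : ((alen a').-1 - (K.-1 - t) = alen a' - K + t)%N by lia.
  by rewrite /shift => ->.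
have ewt t : aword a t = aword a' (alen a' - alen a + t)%N.
  (* By periodicity the equality extends backwards: read it [alen a - K] letters earlier, after
     [alen a'] full turns. *)
  have := congr1 (fun w => w (L * alen a' - (alen a - K) + t)%N) ew.
  have per w m n : periodic L w -> w (L * m + n)%N = w n.
    by move=> pw; elim: m => [|m IH]; rewrite ?muln0 // mulnS -addnA pw.
  have big : (alen a <= L * alen a')%N by apply: leq_trans le _; rewrite leq_pmull.
  rewrite /shift.
  have -> : (alen a - K + (L * alen a' - (alen a - K) + t) = L * alen a' + t)%N by lia.
  have -> : (alen a' - K + (L * alen a' - (alen a - K) + t) =
             L * alen a' + (alen a' - alen a + t))%N by lia.
  by rewrite !per //; exact: (sc_periodic sc).
have ews : aword a = shift (aword a') (alen a' - alen a) by apply/funext.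
have es : asrc a = pos Z (aword a') (asrc a') (alen a' - alen a).
  apply: (@pos_inj _ _ gZ (aword a) (alen a)); rewrite -[LHS]/(tgt a) et /tgt.
  by rewrite ews -posD; congr pos; lia.
have en : alen a' = alen a.
  apply/eqP; rewrite eqn_leq le andbT leqNgt; apply/negP => lt; apply: c.
  rewrite es ewt.
  have -> : (alen a' - alen a + L.-1 = L + (alen a' - alen a).-1)%N by lia.
  rewrite (sc_periodic sc Rw').
  have e : (alen a' - alen a = (alen a' - alen a).-1.+1)%N by lia.
  rewrite {2}e posS; apply/op_act => //.
  by apply: p'; lia.
apply: src_inj => //.
by rewrite es en subnn.
Qed.

Lemma tgt_inj a a' : pending a -> pending a' -> tgt a = tgt a' -> a = a'.
Proof.
move=> pa pa' e; have [le|lt] := leqP (alen a) (alen a').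
  exact: tgt_inj_le.
by symmetry; apply: tgt_inj_le => //; apply: ltnW.
Qed.

(** Otherwise the first [K] letters of one relator would be inverse to [K] letters of another
    one. *)
Lemma src_neq_tgt a a' : pending a -> pending a' -> asrc a <> tgt a'.
Proof.
move=> pa pa' e; have [_ _ ge' _ _] := pa'.
apply: (sc_inv_piece sc (pending_rel pa) (sc_shift sc (alen a' - K) (pending_rel pa'))).
move=> t lt; rewrite -src_label // ?e ?tgt_label //; try lia.
by rewrite /shift; congr aword; lia.
Qed.

Definition gap a := (L - alen a)%N.

Definition bridge a j g := Bridge q (aword a) (asrc a) (alen a) j g.

(** The arc of [a] leads from [tgt a] through [gap a] letters to [asrc a]; [node a j] is the point
    reached after [j] of them. *)
Definition node a j :=
  if j is j'.+1 then
    if j == gap a then asrc a else bridge a j' (aword a (alen a + j')%N).2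
  else tgt a.

Definition chart (o : arc * nat) g :=
  if g == 1 then node o.1 o.2
  else if g == (aword o.1 (alen o.1 + o.2)%N).2 then node o.1 o.2.+1
  else bridge o.1 o.2 g.

Definition slot (o : arc * nat) := (aword o.1 (alen o.1 + o.2)%N).1.

Definition bridging (o : arc * nat) := pending o.1 /\ (o.2 < gap o.1)%N.

Definition close := ext Z bridging slot chart.
Arguments close : simpl never.

Lemma gap_gt a : pending a -> (2 * K <= gap a)%N.
Proof. by move=> /pending_lt; rewrite /gap; lia. Qed.

Lemma bridge_inj a j g a' j' g' : bridge a j g = bridge a' j' g' -> [/\ a = a', j = j' & g = g'].
Proof. by case: a a' => [w x n] [w' x' n'] [/= -> -> -> -> ->]. Qed.

Variant chart_spec a j g : point B -> Prop :=
  | ChartTgt of j = 0%N & g = 1 : chart_spec a j g (tgt a)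
  | ChartSrc of j.+1 = gap a & g = (aword a (alen a + j)%N).2 :
      chart_spec a j g (asrc a)
  | ChartFoot j' of j = j'.+1 & g = 1 :
      chart_spec a j g (bridge a j' (aword a (alen a + j')%N).2)
  | ChartMd of g <> 1 & (j.+1 = gap a -> g <> (aword a (alen a + j)%N).2) :
      chart_spec a j g (bridge a j g).

Lemma letter_neq1 a n : pending a -> (aword a n).2 != 1.
Proof. by case=> Rw *; exact: (sc_neq1 sc). Qed.

Lemma letter_alt a n : pending a -> (aword a n).1 != (aword a n.+1).1.
Proof. by case=> Rw *; exact: (sc_alt sc). Qed.

(** The only points of an orbit of the arc that have a second name, or that are not new, are
    its two nodes. *)
Lemma chartP a j g : bridging (a, j) -> chart_spec a j g (chart (a, j) g).
Proof.
move=> [/= pa lt]; rewrite /chart /=.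
case: eqP => [->|g1].
  case: j lt => [|j] lt; first by constructor.
  by rewrite /node ltn_eqF //; constructor.
case: eqP => [e|ne]; last by constructor.
rewrite /node; case: eqP => [e'|ne]; first by constructor.
by rewrite -e; constructor.
Qed.

Lemma tgt_neq_bridge a a' j g : pending a -> tgt a <> bridge a' j g.
Proof. by move=> /tgt_depth + e; rewrite e /=; lia. Qed.

Lemma src_neq_bridge a a' j g : pending a -> asrc a <> bridge a' j g.
Proof. by move=> /src_depth + e; rewrite e /=; lia. Qed.

Lemma chart_inj o o' g g' : bridging o -> bridging o' -> slot o = slot o' ->
  chart o g = chart o' g' -> o = o' /\ g = g'.
Proof.
case: o o' => [a j] [a' j'] V V'; have [/= pa _] := V; have [/= pa' _] := V'.
rewrite /slot /=; case: (chartP g V) => /= [j0 g1|jM gl|i ji g1|g1 ng];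
  case: (chartP g' V') => /= [j0' g1'|jM' gl'|i' ji' g1'|g1' ng'] es e.
- by rewrite (tgt_inj pa pa' e) j0 j0' g1 g1'.
- by case: (src_neq_tgt pa' pa).
- by case: (tgt_neq_bridge pa e).
- by case: (tgt_neq_bridge pa e).
- by case: (src_neq_tgt pa pa').
- have ea := src_inj pa pa' e; rewrite -{}ea in jM' gl' *.
  have ej : j = j' by apply: succn_inj; rewrite jM jM'.
  by rewrite gl gl' ej.
- by case: (src_neq_bridge pa e).
- by case: (src_neq_bridge pa e).
- by case: (tgt_neq_bridge pa' (esym e)).
- by case: (src_neq_bridge pa' (esym e)).
- by have [-> ei _] := bridge_inj e; rewrite ji ji' ei g1 g1'.
- have [ea ei _] := bridge_inj e; move: es; rewrite -ea -ei ji addnS.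
  by move=> /esym/eqP; rewrite (negPf (letter_alt _ pa)).
- by case: (tgt_neq_bridge pa' (esym e)).
- by case: (src_neq_bridge pa' (esym e)).
- have [ea ei _] := bridge_inj e; move: es; rewrite -ea ei ji' addnS.
  by move=> /eqP; rewrite (negPf (letter_alt _ pa)).
- by have [-> -> ->] := bridge_inj e.
Qed.

Lemma grow_bridge i a j g : ~ op Z i (bridge a j g).
Proof.
case=> [/(old_block fX) /=|[[[s i'] h] [[k /= sp] _]]]; first by lia.
rewrite /sprout; case: eqP => //= _ e; rewrite {}e in sp.
by inversion sp => //; move: H => /=; lia.
Qed.

Lemma chart_closed o g : bridging o -> ~ op Z (slot o) (chart o g).
Proof.
case: o => a j V; have [/= pa lt] := V; have [_ _ _ ct cs] := pa; rewrite /slot /=.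
case: (chartP g V) => [-> _|e _|*|*]; try exact: grow_bridge.
  by rewrite addn0; exact: ct.
have -> // : (alen a + j = L.-1)%N by move: e lt; rewrite /gap; lia.
Qed.

Lemma close_good : good close.
Proof. by apply: ext_good; [exact: gZ|exact: chart_inj|exact: chart_closed]. Qed.

Lemma close_extends : extends Z close.
Proof. exact: ext_extends. Qed.

Lemma close_fresh : fresh q.+1 close.
Proof.
move=> i u lt [/(grow_fresh K0 fX lt) //|[[[a j] g] [/= V es e]]].
have le k v : op Z k v -> (block v <= q.+1)%N.
  by rewrite leqNgt => ov; apply/negP => /(grow_fresh K0 fX) /(_ ov).
have [[/= Rw p ge _ _] _] := V.
suff: (block u <= q.+1)%N by rewrite leqNgt lt.
rewrite -{}e; case: (chartP g V) => *.
- apply: (le (aword a (alen a).-1).1).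
  rewrite /tgt -{2}[alen a]prednK ?posS; last by lia.
  by apply/op_act => //; apply: p; lia.
- by apply: (le (aword a 0%N).1); apply: (p 0%N); lia.
- exact: leqnn.
- exact: leqnn.
Qed.

(** * Walks that cross an arc *)

Local Notation C := close.
Let gC : good C. Proof. exact: close_good. Qed.

Lemma close_opP i u : op C i u -> op Z i u \/
  exists a j g, [/\ bridging (a, j), (aword a (alen a + j)%N).1 = i & chart (a, j) g = u].
Proof. by case=> [o|[[[a j] g] V]]; [left|right; exists a, j, g]. Qed.

Lemma chart_op a j g : bridging (a, j) -> op C (aword a (alen a + j)%N).1 (chart (a, j) g).
Proof. by move=> V; right; exists ((a, j), g). Qed.

Lemma chart_act a j b g : bridging (a, j) ->
  act C (aword a (alen a + j)%N).1 b (chart (a, j) g) = chart (a, j) (b * g).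
Proof. by move=> V; exact: (ext_actV chart_inj chart_closed b g V). Qed.

Lemma chart1 a j : chart (a, j) 1 = node a j.
Proof. by rewrite /chart eqxx. Qed.

Lemma chart_letter a j : pending a ->
  chart (a, j) (aword a (alen a + j)%N).2 = node a j.+1.
Proof. by move=> pa; rewrite /chart eqxx (negPf (letter_neq1 _ pa)). Qed.

Lemma node_op a j : bridging (a, j) -> op C (aword a (alen a + j)%N).1 (node a j).
Proof. by rewrite -chart1; exact: chart_op. Qed.

Lemma node_act a j : bridging (a, j) ->
  act C (aword a (alen a + j)%N).1 (aword a (alen a + j)%N).2 (node a j) =
  node a j.+1.
Proof.
by move=> V; rewrite -chart1 chart_act // mulg1 chart_letter //; case: V.
Qed.

Lemma node_pos a j : pending a -> (j <= gap a)%N ->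
  pos C (aword a) (asrc a) (alen a + j) = node a j.
Proof.
move=> pa; elim: j => [|j IH] le.
  by rewrite addn0 (pos_extends close_extends.2 (pending_walk pa)).
by rewrite addnS posS IH ?node_act //; lia.
Qed.

Lemma node_gap a : pending a -> node a (gap a) = asrc a.
Proof. by move=> /gap_gt; rewrite /node; case: (gap a) => [|j]; [lia|rewrite eqxx]. Qed.

Lemma pending_loop a : pending a -> loop C L (aword a) (asrc a).
Proof.
move=> pa; have := gap_gt pa; rewrite {1}/gap => ?.
have e : L = (alen a + gap a)%N by rewrite /gap; lia.
split; last by rewrite {1}e node_pos // node_gap.
rewrite {1}e; apply: walk_cat.
  exact: walk_extends close_extends (pending_walk pa).
move=> t lt; rewrite -posD node_pos //; last by apply: ltnW.
exact: node_op.
Qed.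

Lemma node_loop a j : pending a -> (j <= gap a)%N ->
  loop C L (shift (aword a) (alen a + j)) (node a j).
Proof.
move=> pa le; rewrite -node_pos //.
by apply: loop_shift (pending_loop pa) => //; apply: (sc_periodic sc); case: pa.
Qed.

(** The other points of the orbit are fixed by all other copies of [B]. *)
Lemma chart_leave a j g i : bridging (a, j) -> op C i (chart (a, j) g) ->
  i != (aword a (alen a + j)%N).1 -> g = 1 \/ g = (aword a (alen a + j)%N).2.
Proof.
move=> V o ne; have [/eqP g1|g1] := boolP (g == 1); first by left.
have [/eqP gl|gl] := boolP (g == (aword a (alen a + j)%N).2); first by right.
move: o; rewrite /chart /= (negPf g1) (negPf gl) => -[/grow_bridge //|].
move=> [[[a' j'] g'] [/= V' es]]; have pa' : pending a' by case: V'.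
case: (chartP g' V') => [||i' ? ?|? ?] e.
- by move=> _ /(tgt_neq_bridge pa').
- by move=> _ /(src_neq_bridge pa').
- by have [? ? ?] := bridge_inj e; subst; rewrite eqxx in gl.
- by have [? ? ?] := bridge_inj e; subst; rewrite eqxx in ne.
Qed.

(** At an inner node only the orbits of the two adjacent letters of the arc are present. *)
Lemma node_next a j i g i' : pending a -> (0 < j < gap a)%N ->
  op C i (node a j) -> g != 1 -> op C i' (act C i g (node a j)) -> i' != i ->
  (i, g) = aword a (alen a + j)%N \/ (i, g) = linv (aword a (alen a + j.-1)%N).
Proof.
move=> pa; case: j => [//|j] /andP[_ lt].
have -> : node a j.+1 = bridge a j (aword a (alen a + j)%N).2 by rewrite /node ltn_eqF.
move=> /close_opP[/grow_bridge //|[a' [j' [h [V <- eu]]]]]; have pa' : pending a' by case: V.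
rewrite -eu => g1; rewrite chart_act // => o ne.
have := chart_leave V o ne; case: (chartP h V) eu => [_ _|_ _|j1 -> ->|h1 _].
- by move=> /(tgt_neq_bridge pa').
- by move=> /(src_neq_bridge pa').
- move=> /bridge_inj [-> -> _]; rewrite mulg1 => -[e|->]; first by rewrite e eqxx in g1.
  by left; rewrite -surjective_pairing.
- move=> /bridge_inj [-> -> ->] [e|e].
    right; rewrite /linv; congr (_, _); apply/(mulIg (aword a (alen a + j)%N).2).
    by rewrite e mulVg.
  by case/eqP: g1; apply/(mulIg (aword a (alen a + j)%N).2); rewrite e mul1g.
Qed.

(** Hence a reduced walk that has entered an arc follows it to its end, except perhaps for the
    last letter of the walk. *)
Lemma chain_fwd a j v N : pending a -> (0 < j)%N -> walk C v (node a j) N ->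
  reduced v N -> (v 0%N).1 != (aword a (alen a + j.-1)%N).1 ->
  forall s, (s < N)%N -> (j + s <= gap a)%N ->
    [/\ pos C v (node a j) s = node a (j + s),
        (v s).1 != (aword a (alen a + (j + s).-1)%N).1 &
        (s.+1 < N)%N -> (j + s < gap a)%N -> v s = aword a (alen a + (j + s))%N].
Proof.
move=> pa j0 p [r1 r2] ne.
have nx t : (t.+1 < N)%N -> (j + t < gap a)%N -> pos C v (node a j) t = node a (j + t) ->
    (v t).1 != (aword a (alen a + (j + t).-1)%N).1 -> v t = aword a (alen a + (j + t))%N.
  move=> tN lt e nt; have := p t (ltnW tN); have := p t.+1 tN; rewrite posS e => o' o.
  have jt : (0 < j + t < gap a)%N by lia.
  case: (node_next pa jt o (r1 t (ltnW tN)) o').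
  - by rewrite eq_sym; apply: r2.
  - by rewrite -surjective_pairing.
  - by rewrite -surjective_pairing => e'; rewrite e' eqxx in nt.
elim=> [|s IH] sN le.
  by rewrite addn0; split=> // N1 lt; have := nx 0%N; rewrite addn0; apply.
have [e n _] := IH (ltnW sN) ltac:(lia).
have lt : (j + s < gap a)%N by lia.
have ev := nx s sN lt e n.
have e' : pos C v (node a j) s.+1 = node a (j + s.+1).
  by rewrite posS e ev node_act ?addnS.
have n' : (v s.+1).1 != (aword a (alen a + (j + s.+1).-1)%N).1.
  by rewrite addnS /= -ev eq_sym; apply: r2.
by split=> // *; apply: nx.
Qed.

Lemma chain_bwd a j v N : pending a -> (j < gap a)%N -> walk C v (node a j) N ->
  reduced v N -> (v 0%N).1 != (aword a (alen a + j)%N).1 ->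
  forall s, (s < N)%N -> (s <= j)%N ->
    [/\ pos C v (node a j) s = node a (j - s),
        (v s).1 != (aword a (alen a + (j - s))%N).1 &
        (s.+1 < N)%N -> (s < j)%N -> v s = linv (aword a (alen a + (j - s).-1)%N)].
Proof.
move=> pa j0 p [r1 r2] ne.
have nx t : (t.+1 < N)%N -> (t < j)%N -> pos C v (node a j) t = node a (j - t) ->
    (v t).1 != (aword a (alen a + (j - t))%N).1 -> v t = linv (aword a (alen a + (j - t).-1)%N).
  move=> tN lt e nt; have := p t (ltnW tN); have := p t.+1 tN; rewrite posS e => o' o.
  have jt : (0 < j - t < gap a)%N by lia.
  case: (node_next pa jt o (r1 t (ltnW tN)) o').
  - by rewrite eq_sym; apply: r2.
  - by rewrite -surjective_pairing => e'; rewrite e' eqxx in nt.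
  - by rewrite -surjective_pairing.
elim=> [|s IH] sN le.
  by rewrite subn0; split=> // N1 lt; have := nx 0%N; rewrite subn0; apply.
have [e n _] := IH (ltnW sN) ltac:(lia).
have ev := nx s sN le e n.
have e0 : (j - s = (j - s.+1).+1)%N by lia.
have e' : pos C v (node a j) s.+1 = node a (j - s.+1).
  rewrite posS e ev e0 -node_act /=; last by split=> //=; lia.
  exact: (actK gC).
have n' : (v s.+1).1 != (aword a (alen a + (j - s.+1))%N).1.
  by have := r2 s sN; rewrite ev e0 eq_sym.
by split=> // *; apply: nx.
Qed.

(** The word [v] contains [K] letters of a relator, or of the inverse of a relator, whose
    loop passes through the walk at that place. *)
Definition matches v u N := exists t w, [/\ R w, (t + K <= N)%N &
  ((forall s, (s < K)%N -> v (t + s)%N = w s) /\ loop C L w (pos C v u t)) \/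
  ((forall s, (s < K)%N -> v (t + s)%N = linv (w (K.-1 - s)%N)) /\
    loop C L w (pos C v u (t + K)))].

Lemma matches_shift v u k N : matches (shift v k) (pos C v u k) N ->
  matches v u (k + N).
Proof.
move=> [t [w [Rw le h]]]; exists (k + t)%N, w; split=> //; first by lia.
rewrite -addnA -!posD in h *.
case: h => -[e l]; [left|right]; split=> // s /e <-; by rewrite /shift addnA.
Qed.

Lemma match_fwd a j v N : pending a -> (0 < j)%N -> (j + K <= gap a)%N ->
  walk C v (node a j) N -> reduced v N ->
  (v 0%N).1 != (aword a (alen a + j.-1)%N).1 -> (K + 2 <= N)%N ->
  matches v (node a j) N.
Proof.
move=> pa j0 le p r ne NK; exists 0%N, (shift (aword a) (alen a + j)).
split; [by case: pa => Rw *; exact: (sc_shift sc)|by lia|left].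
split; last by apply: node_loop => //; lia.
move=> s lt; have [_ _ e] := chain_fwd pa j0 p r ne (s := s) ltac:(lia) ltac:(lia).
by rewrite add0n e /shift ?addnA //; lia.
Qed.

Lemma match_bwd a j v N : pending a -> (K <= j < gap a)%N ->
  walk C v (node a j) N -> reduced v N ->
  (v 0%N).1 != (aword a (alen a + j)%N).1 -> (K + 2 <= N)%N ->
  matches v (node a j) N.
Proof.
move=> pa /andP[j0 jg] p r ne NK; exists 0%N, (shift (aword a) (alen a + (j - K))).
split; [by case: pa => Rw *; exact: (sc_shift sc)|by lia|right].
have ch s := chain_bwd pa jg p r ne (s := s).
split; last first.
  by have [-> _ _] := ch K ltac:(lia) j0; apply: node_loop => //; lia.
move=> s lt; have [_ _ e] := ch s ltac:(lia) ltac:(lia).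
rewrite add0n e /shift; try lia.
by congr (linv (aword a _)); lia.
Qed.

Lemma mid_start v u N : ~ op Z (v 0%N).1 u -> walk C v u N -> reduced v N ->
  (2 <= N)%N -> exists a j h, [/\ bridging (a, j), u = chart (a, j) h,
    (v 0%N).1 = (aword a (alen a + j)%N).1 &
    (v 0%N).2 * h = (aword a (alen a + j)%N).2 /\ pos C v u 1 = node a j.+1 \/
    (v 0%N).2 * h = 1 /\ pos C v u 1 = node a j].
Proof.
move=> c p r N2; have [//|[a [j [h [V es eu]]]]] := close_opP (p 0%N ltac:(lia)).
exists a, j, h; have pa : pending a by case: V.
have e1 : pos C v u 1 = chart (a, j) ((v 0%N).2 * h).
  by rewrite posS -es -[pos C v u 0]eu chart_act.
have o := p 1%N N2; rewrite e1 in o.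
have ne : (v 1%N).1 != (aword a (alen a + j)%N).1.
  by rewrite es eq_sym; apply: r.2.
split=> //.
by case: (chart_leave V o ne) => e; [right|left];
  rewrite e1 e ?chart1 ?chart_letter.
Qed.

Lemma src_gap a j : (j.+1 = gap a)%N -> (aword a (alen a + j)%N).1 = (aword a L.-1).1.
Proof. by rewrite /gap => e; congr (aword a _).1; lia. Qed.

(** An arc entered from a point that is not new is entered at one of its ends, so the walk has
    to follow it from there. *)
Lemma match_leaf v u N k : op Z k u -> ~ op Z (v 0%N).1 u -> walk C v u N ->
  reduced v N -> (K + 3 <= N)%N -> matches v u N.
Proof.
move=> ou c p r le; have [a [j [h [V eu es cases]]]] := mid_start c p r ltac:(lia).
have pa : pending a by case: V.
have lt : (j < gap a)%N by case: V.
have gg := gap_gt pa.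
have eN : N = (1 + N.-1)%N by lia.
have p' : walk C (shift v 1) (pos C v u 1) N.-1 by apply: walk_shift; rewrite -eN.
have r' : reduced (shift v 1) N.-1 by apply: reduced_shift; rewrite -eN.
have v1 : (shift v 1 0%N).1 != (aword a (alen a + j)%N).1.
  by rewrite -es eq_sym; apply: r.2; lia.
have v0 : (v 0%N).2 != 1 by apply: r.1; lia.
rewrite eN; apply: matches_shift.
case: (chartP h V) eu => [j0 h1 _|jM hl _|j' _ _ e|_ _ e].
- case: cases => -[e0 e1]; last by rewrite -e0 h1 mulg1 eqxx in v0.
  by rewrite e1 in p' *; subst j; apply: match_fwd => //; lia.
- case: cases => -[e0 e1].
    by case/eqP: v0; apply: (mulIg h); rewrite e0 hl mul1g.
  by rewrite e1 in p' *; apply: match_bwd => //; lia.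
- by rewrite e in ou; case: (grow_bridge ou).
- by rewrite e in ou; case: (grow_bridge ou).
Qed.

Lemma chart_src a j h a' : pending a' -> bridging (a, j) -> chart (a, j) h = asrc a' ->
  (aword a (alen a + j)%N).1 = (aword a' L.-1).1.
Proof.
move=> pa' V; have [/= pa _] := V; case: (chartP h V) => [_ _ e|jM _ e|j' _ _ e|_ _ e].
- by case: (src_neq_tgt pa' pa).
- by rewrite (src_inj pa pa' e) in jM *; exact: src_gap.
- by case: (src_neq_bridge pa' (esym e)).
- by case: (src_neq_bridge pa' (esym e)).
Qed.

Lemma chart_tgt a j h a' : pending a' -> bridging (a, j) -> chart (a, j) h = tgt a' ->
  (aword a (alen a + j)%N).1 = (aword a' (alen a')).1.
Proof.
move=> pa' V; have [/= pa _] := V; case: (chartP h V) => [-> _ e|jM _ e|j' _ _ e|_ _ e].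
- by rewrite (tgt_inj pa pa' e) addn0.
- by case: (src_neq_tgt pa pa').
- by case: (tgt_neq_bridge pa' (esym e)).
- by case: (tgt_neq_bridge pa' (esym e)).
Qed.

(** If the first [K.*2.+1] steps from the summit [e] cross no arc, then the first [K] of them
    descend along the letters recorded by [e], by [summit_start]. Otherwise the first arc on the
    way is entered from a point that is not new. *)
Lemma descend e v N : (K <= depth q e)%N -> walk C v e N -> reduced v N ->
  (3 * K + 4 <= N)%N -> op Z (v 0%N).1 e ->
  (forall t, (t < K)%N -> label (iter t (@parent B) e) = linv (v t)) \/
  matches v e N.
Proof.
move=> d p r le o0.
have [all|/existsNP[t]] := pselect (forall t, (t < K.*2.+1)%N -> op Z (v t).1 (pos C v e t)).
  left=> t lt; have pZ : walk Z v e K.*2.+1 by apply: walk_restrict close_extends _.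
  by apply: (summit_start K0 gX fX pZ) => //; apply: reduced_leq r; lia.
move=> /not_implyP[t2 ct]; right.
elim/ltn_ind: t t2 ct => t IH t2 ct.
case: t => [//|t] in IH t2 ct *.
have [ot|nt] := pselect (op Z (v t).1 (pos C v e t)); last first.
  by apply: (IH t) => //; lia.
have eN : N = (t.+1 + (N - t.+1))%N by lia.
rewrite eN; apply: matches_shift; apply: (match_leaf (k := (v t).1)).
- by rewrite posS close_extends.2 //; apply/op_act.
- by rewrite /shift addn0.
- by apply: walk_shift; rewrite -eN.
- by apply: reduced_shift; rewrite -eN.
- by lia.
Qed.

Lemma match_src a v N : pending a -> walk C v (asrc a) N -> reduced v N ->
  (3 * K + 4 <= N)%N -> (v 0%N).1 != (aword a L.-1).1 -> matches v (asrc a) N.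
Proof.
move=> pa p r le ne.
have o : op Z (v 0%N).1 (asrc a).
  have [//|[a' [j [h [V es eu]]]]] := close_opP (p 0%N ltac:(lia)).
  by move: ne; rewrite -(chart_src pa V eu) -es eqxx.
case: (descend (src_depth pa) p r le o) => // e.
exists 0%N, (aword a); split; [by case: pa|by lia|left]; split; last exact: pending_loop.
by move=> s lt; apply: linv_inj; rewrite -e // src_label.
Qed.

Lemma match_tgt a v N : pending a -> walk C v (tgt a) N -> reduced v N ->
  (3 * K + 4 <= N)%N -> (v 0%N).1 != (aword a (alen a)).1 -> matches v (tgt a) N.
Proof.
move=> pa p r le ne; have [Rw pw ge _ _] := pa.
have o : op Z (v 0%N).1 (tgt a).
  have [//|[a' [j [h [V es eu]]]]] := close_opP (p 0%N ltac:(lia)).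
  by move: ne; rewrite -(chart_tgt pa V eu) -es eqxx.
case: (descend (tgt_depth pa) p r le o) => // e.
have ev s : (s < K)%N -> v s = linv (aword a ((alen a).-1 - s)%N).
  by move=> lt; rewrite -tgt_label // e // linvK.
exists 0%N, (shift (aword a) (alen a - K)).
split; [exact: (sc_shift sc)|by lia|right]; split=> [s lt|].
  by rewrite ev // /shift; congr (linv (aword a _)); lia.
have ep : pos C (aword a) (asrc a) (alen a - K) = pos C v (tgt a) K.
  rewrite (@eq_pos _ C v (rev_word (aword a) (alen a))); last by move=> t; apply: ev.
  by rewrite -[tgt a](pos_extends close_extends.2 pw) // pos_rev //; lia.
rewrite add0n -ep; apply: loop_shift => //; first exact: (sc_periodic sc).
exact: pending_loop.
Qed.

(** The walk follows the arc that it crosses first. If it reaches an end of the arc before it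
    has spelled [K] letters, it goes on from there as in [match_src] or [match_tgt]. *)
Lemma match_mid v u N : ~ op Z (v 0%N).1 u -> walk C v u N -> reduced v N ->
  (5 * K <= N)%N -> matches v u N.
Proof.
move=> c p r le; have [a [j [h [V eu es cases]]]] := mid_start c p r ltac:(lia).
have pa : pending a by case: V.
have lt : (j < gap a)%N by case: V.
have gg := gap_gt pa.
have eN : N = (1 + N.-1)%N by lia.
have p' : walk C (shift v 1) (pos C v u 1) N.-1 by apply: walk_shift; rewrite -eN.
have r' : reduced (shift v 1) N.-1 by apply: reduced_shift; rewrite -eN.
have v1 : (shift v 1 0%N).1 != (aword a (alen a + j)%N).1.
  by rewrite -es eq_sym; apply: r.2; lia.
have sub k : (k <= K)%N -> N.-1 = (k + (N.-1 - k))%N by lia.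
rewrite eN; apply: matches_shift; case: cases => -[_ e1]; rewrite {}e1 in p' *.
  have [far|near] := leqP (j.+1 + K) (gap a); first by apply: match_fwd => //; lia.
  pose k := (gap a - j.+1)%N; have kK : (k <= K)%N by rewrite /k; lia.
  have [ep n _] := chain_fwd pa (ltn0Sn j) p' r' v1 (s := k) ltac:(lia) ltac:(lia).
  have ek : (j.+1 + k = gap a)%N by rewrite /k; lia.
  rewrite ek in ep n; rewrite node_gap // in ep.
  rewrite (sub k) //; apply: matches_shift; rewrite ep.
  apply: match_src => //.
  - by rewrite -ep; apply: walk_shift; rewrite -sub.
  - by apply: reduced_shift; rewrite -sub.
  - by lia.
  - by rewrite /shift addn0 -(@src_gap a (gap a).-1) //; lia.
have [far|near] := leqP K j; first by apply: match_bwd => //; lia.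
have [ep n _] := chain_bwd pa lt p' r' v1 (s := j) ltac:(lia) (leqnn j).
rewrite subnn in ep n.
rewrite (sub j); last by lia.
apply: matches_shift; rewrite ep.
apply: match_tgt => //.
- by rewrite -[tgt a]/(node a 0) -ep; apply: walk_shift; rewrite -sub //; lia.
- by apply: reduced_shift; rewrite -sub //; lia.
- by lia.
- by rewrite /shift addn0; rewrite addn0 in n.
Qed.

(** A walk along a relator that crosses no arc is closed already, or part of a pending walk, which
    has been closed. If it crosses an arc, apply [match_mid] to the part after this step or to
    the reversed part before it. The piece found is shared with a loop: by the small
    cancellation hypothesis the walk follows this loop. *)
Lemma close_closes_up w u : R w -> walk C w u (10 * K) -> loop C L w u.
Proof.
move=> Rw p; have pw := sc_periodic sc Rw.
have [all|/existsNP[t]] := pselect (forall t, (t < 10 * K)%N -> op Z (w t).1 (pos C w u t)).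
  have pZ : walk Z w u (10 * K) by apply: walk_restrict close_extends all.
  have [l|nl] := pselect (loop Z L w u); first exact: loop_extends close_extends l.
  have [a [k [pa -> -> le]]] := pending_extension Rw pZ (leqnn _) nl.
  rewrite -(pos_extends close_extends.2 (pending_walk pa)); last by lia.
  by apply: loop_shift (pending_loop pa) => //; apply: (sc_periodic sc); case: pa.
move=> /not_implyP[tN ct].
have back k : (k <= 10 * K)%N -> loop C L (shift w k) (pos C w u k) -> loop C L w u.
  by move=> le; apply: loop_unshift => //; apply: walk_leq p.
have [early|late] := leqP (5 * K) (10 * K - t).
  have eN : (10 * K = t + (10 * K - t))%N by lia.
  have p' : walk C (shift w t) (pos C w u t) (10 * K - t) by apply: walk_shift; rewrite -eN.
  have := match_mid _ p' (sc_reduced _ (sc_shift sc t Rw)) early.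
  rewrite {1}/shift addn0 => /(_ ct) [s [w' [Rw' le [[e l]|[e l]]]]].
    apply: (back (t + s)%N); first by lia.
    rewrite posD; suff -> : shift w (t + s) = w' by [].
    apply: (sc_piece sc) => // [|i lt]; first exact: (sc_shift sc).
    by rewrite -e // /shift addnA.
  case: (sc_inv_piece sc Rw' (sc_shift sc (t + s) Rw)) => i lt.
  by rewrite -e // /shift addnA.
(* The reversed walk begins with the reversal of the step that crosses an arc. *)
pose v := rev_word w t.+1.
have pt1 : walk C w u t.+1 by apply: walk_leq p.
have p' : walk C v (pos C w u t.+1) t.+1 by apply: walk_rev.
have c' : ~ op Z (v 0%N).1 (pos C w u t.+1).
  rewrite /v /rev_word /= subn0 => o; apply: ct.
  have e : pos C w u t = act C (w t).1 (w t).2^-1 (pos C w u t.+1).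
    by rewrite posS actK.
  by rewrite e close_extends.2 //; apply/op_act.
have := match_mid c' p' (reduced_rev (sc_reduced _ Rw)) ltac:(lia).
move=> [s [w' [Rw' le [[e l]|[e l]]]]].
  case: (sc_inv_piece sc (sc_shift sc (t.+1 - s - K) Rw) Rw') => i lt.
  by rewrite -e // /v /rev_word /shift; congr (linv (w _)); lia.
rewrite pos_rev // in l.
apply: (back (t.+1 - (s + K))%N); first by lia.
suff <- : w' = shift w (t.+1 - (s + K)) by exact: l.
apply: (sc_piece sc) => // [|i lt]; first exact: (sc_shift sc).
have lt' : (K.-1 - i < K)%N by lia.
have := e _ lt'; rewrite subKn; last by lia.
move=> e'; apply: linv_inj; rewrite -e' /v /rev_word /shift; congr (linv (w _)).
by lia.
Qed.

End Close.

(** * The limit action *)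

Section Limit.
Variables (B : groupType) (K L : nat) (R : word B -> Prop).
Hypothesis sc : small_cancellation K L R.

Fixpoint stage q : structure B :=
  if q is q'.+1 then close K L R q' (stage q')
  else Structure (fun _ _ => False) (fun _ _ u => u).

Let K0 : (0 < K)%N. Proof. by have [] := sc_size sc; lia. Qed.

Lemma stage_invariant q :
  [/\ good (stage q), fresh q (stage q) & closes_up K L R (stage q)].
Proof.
elim: q => [|q [g f c]].
  split=> [|i u _ []|w u _ p]; first by split.
  by case: (p 0%N); rewrite muln_gt0.
by split; [exact: close_good|exact: close_fresh|exact: close_closes_up].
Qed.

Lemma stage_extendsS q : extends (stage q) (stage q.+1).
Proof.
have [g f _] := stage_invariant q.
exact: extends_trans (grow_extends K q _) (close_extends _ _ _ _ _).
Qed.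

Lemma stage_extends m n : (m <= n)%N -> extends (stage m) (stage n).
Proof.
move=> /subnKC <-; elim: (n - m)%N => [|k IH]; first by rewrite addn0; split.
by rewrite addnS; apply: extends_trans IH (stage_extendsS _).
Qed.

Lemma stage_opens i u q : (block u < q)%N -> op (stage q) i u.
Proof.
case: q => // q le; have [g f _] := stage_invariant q.
exact: (close_extends _ _ _ _ _).1 (grow_opens _ _ _ _).
Qed.

(** A point is moved by all copies of [B] from the step after its creation on. *)
Definition limit := Structure (fun _ (_ : point B) => True)
  (fun i b u => act (stage (block u).+1) i b u).

Lemma stage_act i b u q : (block u < q)%N -> act (stage q) i b u = act limit i b u.
Proof. by move=> le; apply: (stage_extends le).2; exact: stage_opens. Qed.

Lemma limit_good : good limit.
Proof.
have big (u v : point B) : exists q, (block u < q)%N && (block v < q)%N.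
  by exists (block u + block v).+1; lia.
split=> [i u|i b c u|i b u _|i b u []] //.
- by have [g _ _] := stage_invariant (block u).+1; exact: (act1 g).
- have [q /andP[lu lv]] := big u (act limit i c u).
  have [g _ _] := stage_invariant q.
  by rewrite -!(@stage_act _ _ _ q) ?(actM g) // stage_act.
- have [g _ _] := stage_invariant (block u).+1.
  by apply: (act_free g); exact: stage_opens.
Qed.

Lemma limit_pos w u n : exists2 q0, True & forall q, (q0 <= q)%N ->
  walk (stage q) w u n /\ pos (stage q) w u n = pos limit w u n.
Proof.
elim: n => [|n [q0 _ IH]]; first by exists 0%N.
exists (maxn q0 (block (pos limit w u n)).+1) => // q; rewrite geq_max => /andP[/IH[p e] lt].
split; last by rewrite !posS e stage_act.
move=> t; rewrite ltnS leq_eqVlt => /predU1P[->|/p //].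
by rewrite e; exact: stage_opens.
Qed.

(** In the limit every walk of [10 * K] letters exists, and it exists at a finite stage. *)
Theorem limit_relator w u : R w -> pos limit w u L = u.
Proof.
move=> Rw; have [q1 _ h1] := limit_pos w u (10 * K).
have [q2 _ h2] := limit_pos w u L.
have [p _] := h1 (maxn q1 q2) (leq_maxl _ _).
have [_ <-] := h2 (maxn q1 q2) (leq_maxr _ _).
have [_ _ c] := stage_invariant (maxn q1 q2).
by have [_ ->] := c w u Rw p.
Qed.

End Limit.

(** * An aperiodic pattern *)

(** The letters of a relator that expresses [y] by elements of [G] and a letter [t], up to the
    choice of these: the letter [y^-1], the letters [t], the elements of [G] that follow a bit
    pattern, and the two elements of [G] that are adjusted to make their product trivial. The
    latter may coincide with any other element of [G]. *)
Variant token := TokY | TokT | TokBit of bool | TokWild.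

Definition compat (x y : token) := match x, y with
  | TokY, TokY | TokT, TokT | TokWild, TokWild
  | TokWild, TokBit _ | TokBit _, TokWild => true
  | TokBit b, TokBit c => b == c
  | _, _ => false
  end.

(** Two elements [a] and [b] of [G] encode the bits. Either [a] and [b] are inverse to each other
    and inversion exchanges the bits, or inversion preserves the bits where it yields [a] or [b]
    at all. *)
Definition inv_compat (flip : bool) (x y : token) := match x, y with
  | TokT, TokT | TokWild, TokWild | TokWild, TokBit _ | TokBit _, TokWild => true
  | TokBit b, TokBit c => b == c (+) flip
  | _, _ => false
  end.

Section Skeleton.
Variables (m : nat) (bit : nat -> bool).

Definition slot_token k :=
  if odd k then
    if (k./2 == 0%N) || (k./2 == m.-1) then TokWild else TokBit (bit k./2)
  else if k == 0%N then TokY else TokT.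

Definition tok n := slot_token (n %% m.*2).

Record aperiodic K : Prop := Aperiodic {
  ap_piece : forall i j, (forall t, (t < K)%N -> compat (tok (i + t)) (tok (j + t))) ->
    i = j %[mod m.*2];
  ap_inv_piece : forall flip i j,
    ~ (forall t, (t < K)%N -> inv_compat flip (tok (j + t)) (tok (i + (K.-1 - t)))) }.

Definition tokens := [seq slot_token k | k <- iota 0 m.*2].

Definition windows K :=
  [seq take K (drop i (tokens ++ tokens)) | i <- iota 0 m.*2].

Definition aperiodicb K :=
  let ws := windows K in
  let rs := [seq rev w | w <- ws] in
  [&& pairwise (fun x y => ~~ all2 compat x y) ws,
    allrel (fun x y => ~~ all2 (inv_compat false) x y) ws rs &
    allrel (fun x y => ~~ all2 (inv_compat true) x y) ws rs].

Section Check.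
Variables (K : nat) (K0 : (0 < K)%N) (KL : (K <= m.*2)%N).

Let L0 : (0 < m.*2)%N. Proof. exact: leq_trans KL. Qed.

Let win i := nth [::] (windows K) (i %% m.*2).

Lemma size_windows : size (windows K) = m.*2.
Proof. by rewrite size_map size_iota. Qed.

Lemma winE i : win i = [seq tok (i + t) | t <- iota 0 K].
Proof.
have sz : size tokens = m.*2 by rewrite size_map size_iota.
have lt : (i %% m.*2 < m.*2)%N by rewrite ltn_mod.
rewrite /win (nth_map 0%N) ?size_iota // nth_iota // add0n.
apply: (@eq_from_nth _ TokY) => [|t].
  by rewrite size_map size_iota size_takel // size_drop size_cat sz; lia.
rewrite size_takel ?size_drop ?size_cat ?sz => [ltK|]; last by lia.
rewrite nth_take // nth_drop nth_cat sz (nth_map 0%N) ?size_iota // nth_iota //.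
rewrite add0n /tok -modnDml; move: (i %% m.*2)%N lt => r lt.
case: ltnP => lt'.
  by rewrite (nth_map 0%N) ?size_iota // nth_iota // modn_small.
have lt2 : (r + t - m.*2 < m.*2)%N by lia.
rewrite (nth_map 0%N) ?size_iota // nth_iota // add0n -[in RHS](subnK lt') modnDr.
by rewrite modn_small.
Qed.

Lemma rev_winE i : rev (win i) = [seq tok (i + (K.-1 - t)) | t <- iota 0 K].
Proof.
rewrite winE; apply: (@eq_from_nth _ TokY); rewrite size_rev !size_map size_iota //.
move=> t lt; rewrite nth_rev ?size_map size_iota //.
have lt' : (K - t.+1 < K)%N by lia.
rewrite !(nth_map 0%N) ?size_iota // !nth_iota // !add0n.
by congr (tok (i + _)); lia.
Qed.

Lemma all2_map_iota (r : rel token) f g n :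
  (forall t, (t < n)%N -> r (f t) (g t)) ->
  all2 r [seq f t | t <- iota 0 n] [seq g t | t <- iota 0 n].
Proof.
move=> h; rewrite all2E !size_map eqxx /= zip_map all_map.
by apply/allP => t; rewrite mem_iota add0n => /andP[_ /h].
Qed.

Lemma compat_sym x y : compat x y = compat y x.
Proof. by case: x; case: y => // b c /=; rewrite eq_sym. Qed.

Lemma aperiodicP : aperiodicb K -> aperiodic K.
Proof.
move=> /and3P[/(pairwiseP [::]) pw inv0 inv1]; split=> [i j e|flip i j e].
  have sep k l : (k %% m.*2 < l %% m.*2)%N ->
      ~ (forall t, (t < K)%N -> compat (tok (k + t)) (tok (l + t))).
    move=> lt e'; have /negP[] : ~~ all2 compat (win k) (win l).
      by apply: pw; rewrite ?inE ?size_windows ?ltn_mod.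
    by rewrite !winE; apply: all2_map_iota.
  case: (ltngtP (i %% m.*2) (j %% m.*2)) => // lt; first by case: (sep _ _ lt).
  by case: (sep _ _ lt) => t /e; rewrite compat_sym.
have /negP[] : ~~ all2 (inv_compat flip) (win j) (rev (win i)); last first.
  by rewrite rev_winE winE; apply: all2_map_iota.
have {inv0 inv1} : allrel (fun x y => ~~ all2 (inv_compat flip) x y)
    (windows K) [seq rev w | w <- windows K] by case: flip {e}.
move=> /(all_nthP [::]) /(_ (j %% m.*2)%N); rewrite size_windows ltn_mod => /(_ L0) /=.
move=> /(all_nthP [::]) /(_ (i %% m.*2)%N); rewrite size_map size_windows ltn_mod => /(_ L0).
by rewrite (nth_map [::]) // size_windows ltn_mod.
Qed.

End Check.

End Skeleton.

(** The linear feedback shift register of the recurrence [x_(n+10) = x_n + x_(n+3)]. *)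
Definition lfsr_step (s : seq bool) := rcons (behead s) (nth false s 0 (+) nth false s 3).

Definition lfsr n :=
  [seq head false s | s <- traject lfsr_step
     [:: false; true; true; true; false; false; false; false; false; false] n].

Definition pattern_window := 30.
(** Odd because of the alternating products in [RelG], and minimal such that a relator has
    [14 * pattern_window] letters. *)
Definition pattern_half := 211.

Definition pattern i := nth false (false :: lfsr pattern_half.-2) i.


(** A finite check of all pairs of places. The initial state of the register is chosen such that
    it succeeds. *)
Lemma pattern_aperiodic : aperiodic pattern_half pattern pattern_window.
Proof. by apply: aperiodicP; vm_compute. Qed.

(** * The relators *)

Section MultiplicativeTheory.
Variables (G H : groupType) (f : {multiplicative G -> H}).

Lemma multiplicative1 : f 1 = 1.
Proof. by apply: (mulgI (f 1)); rewrite -gmulfM !mulg1. Qed.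

Lemma multiplicativeV x : f x^-1 = (f x)^-1.
Proof. by apply: (mulgI (f x)); rewrite -gmulfM !mulgV multiplicative1. Qed.

End MultiplicativeTheory.

Section Relators.
Variables (G B : groupType) (gamma : {multiplicative G -> B}).
Variables (y : B) (zeta : nat -> B) (a b c d : G).
Variables (m K : nat) (bit : nat -> bool).

(** Every relator alternates between [m] letters from copies of [B] with positive index and [m]
    elements of [G], which act through the copy with index [0]. The copy with index [1] contains
    [y], the copy with index [q.+2] contains [zeta q].
    - [RelG h] ties [y] to [h]: the exponents of [y] sum up to [1], and the elements of [G] have
      the product [h].
    - [RelF q] expresses [zeta q] by [y] and [G].
    - [RelE q t] expresses [y] by [t] and [G], by a product that reduces to [y^-1] if [t] is
      killed. *)
Variant relator := RelG of G | RelF of nat | RelE of nat & B.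

Definition valid r := match r with
  | RelG h => h != 1 | RelF q => zeta q != 1 | RelE q t => t != 1 end.

(** At least [2], so that [y^-1] is not the inverse of a power of [y] with a coded exponent. *)
Definition code (o : option nat) (i : nat) := (pickle (o, i)).+2.

Definition code_sum o := (\sum_(1 <= i < m) code o i)%N.

Definition aletter r i : letter B := match r with
  | RelG h => (1%N, if i == 0%N then y ^- (code_sum None).-1 else y ^+ code None i)
  | RelF q => if i == 0%N then (q.+2, (zeta q)^-1) else (1%N, y ^+ code (Some q) i)
  | RelE q t => if i == 0%N then (1%N, y^-1) else (q.+2, t) end.

Definition gletter r i : G := match r with
  | RelG h => if odd i then h^-1 else h
  | RelF _ => a
  | RelE _ _ =>
      if i == 0%N then c else if i == m.-1 then d else if bit i then a else b
  end.

Definition base r : word B := fun n =>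
  let k := (n %% m.*2)%N in
  if odd k then (0%N, gamma (gletter r k./2)) else aletter r k./2.

Definition relators (w : word B) := exists r i, valid r /\ w = shift (base r) i.

Hypotheses (K7 : (7 <= K)%N) (Km : (7 * K <= m)%N).
Hypothesis gamma_inj : injective gamma.
Hypothesis y_inf : forall n, y ^+ n = 1 -> n = 0%N.
Hypotheses (a1 : a != 1) (b1 : b != 1) (c1 : c != 1) (d1 : d != 1) (ab : a != b).
Hypothesis ap : aperiodic m bit K.

Local Notation L := m.*2.

Let L0 : (0 < L)%N. Proof. by lia. Qed.

Lemma code_inj o o' i i' : code o i = code o' i' -> o = o' /\ i = i'.
Proof. by move=> [] /(pcan_inj pickleK) [-> ->]. Qed.

Lemma y_inj i j : y ^+ i = y ^+ j -> i = j.
Proof.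
wlog le : i j / (i <= j)%N => [h e|].
  by case: (leqP i j) => [/h|/ltnW /h h']; [apply|rewrite (h' (esym e))].
rewrite -(subnK le) expgnDr -{1}(mul1g (y ^+ i)) => /mulIg /esym /y_inf e.
by rewrite e.
Qed.

Lemma y_inv i j : y ^+ i = y ^- j -> (i + j = 0)%N.
Proof. by move=> e; apply: y_inf; rewrite expgnDr e mulVg. Qed.

Lemma base_mod r i j : i = j %[mod L] -> base r i = base r j.
Proof. by rewrite /base => ->. Qed.

Lemma shift_base_mod r i j : i = j %[mod L] -> shift (base r) i = shift (base r) j.
Proof.
by move=> e; apply/funext => n; apply: base_mod; rewrite -modnDml e modnDml.
Qed.

Lemma odd_modL n : odd (n %% L) = odd n.
Proof. by rewrite [in RHS](divn_eq n L) oddD oddM odd_double andbF. Qed.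

Lemma base_odd r n : odd n -> base r n = (0%N, gamma (gletter r (n %% L)./2)).
Proof. by rewrite /base odd_modL => ->. Qed.

Lemma base_even r n : ~~ odd n -> base r n = aletter r (n %% L)./2.
Proof. by rewrite /base odd_modL => /negPf ->. Qed.

Lemma aletter_slot r i : (0 < (aletter r i).1)%N.
Proof. by case: r => //= *; case: ifP. Qed.

Lemma base_slot r n : ((base r n).1 == 0%N) = odd n.
Proof.
have [o|e] := boolP (odd n); first by rewrite base_odd.
by rewrite base_even // gtn_eqF // aletter_slot.
Qed.

Lemma code_sum_gt1 o : (2 <= code_sum o)%N.
Proof.
have h : (1 < m)%N by clear -K7 Km; lia.
by rewrite /code_sum big_ltn // /code; lia.
Qed.

Lemma expg_neq1 n : (0 < n)%N -> y ^+ n != 1.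
Proof. by case: n => // n _; apply/eqP => /y_inf. Qed.

Lemma gletter_neq1 r i : valid r -> gletter r i != 1.
Proof.
case: r => [h|q|q t] //= h1; first by case: odd; rewrite ?invg_eq1.
by case: (_ == 0)%N => //; case: (_ == m.-1) => //; case: (bit i).
Qed.

Lemma aletter_neq1 r i : valid r -> (aletter r i).2 != 1.
Proof.
have := code_sum_gt1 None; case: r => [h|q|q t] /= T v.
- by case: ifP => _; rewrite ?invg_eq1 expg_neq1 //; lia.
- by case: ifP => _ /=; rewrite ?invg_eq1 // expg_neq1.
- by case: ifP => _ //=; rewrite invg_eq1 (@expg_neq1 1).
Qed.

(** The first component of the codes in the relator; [RelE] has no codes. *)
Definition coded r := if r is RelE _ _ then None else
  Some (if r is RelF q then Some q else None).

Lemma coded_letter r o n : coded r = Some o -> ~~ odd n -> (n %% L != 0)%N ->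
  base r n = (1%N, y ^+ code o (n %% L)./2).
Proof.
move=> cr e nz; rewrite base_even //.
have nz2 : ((n %% L)./2 == 0%N) = false.
  by move: (odd_modL n) (odd_double_half (n %% L)); rewrite (negPf e) => -> /=; lia.
by case: r cr => [h|q|//] [<-] /=; rewrite nz2.
Qed.

Lemma uncoded_letter q t n k : (2 <= k)%N ->
  base (RelE q t) n <> (1%N, y ^+ k) /\ base (RelE q t) n <> (1%N, y ^- k).
Proof.
move=> k2; have [o|e] := boolP (odd n); first by rewrite base_odd.
rewrite base_even //=; case: ifP => _; split=> -[] //.
  move=> e'; have := @y_inv k 1; rewrite -e' => /(_ erefl); lia.
by move=> /invg_inj /(@y_inj 1); lia.
Qed.

Lemma dvdn_far s t : (s < t < s + L)%N -> ~~ ((L %| s)%N && (L %| t)%N).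
Proof.
move=> h; apply/negP => /andP[ds dt].
have : (L %| t - s)%N by rewrite dvdn_subr //; lia.
by move=> /dvdn_leq; lia.
Qed.

(** Among three positions of the same parity, one avoids the exceptional letter in each of
    two words. *)
Lemma find_position (u v : nat -> nat) (p : bool) :
  (forall s t, (s < t < 6)%N -> ~~ ((L %| u s)%N && (L %| u t)%N)) ->
  (forall s t, (s < t < 6)%N -> ~~ ((L %| v s)%N && (L %| v t)%N)) ->
  exists t, [/\ (t < 6)%N, odd t = p, (u t %% L != 0)%N & (v t %% L != 0)%N].
Proof.
move=> hu hv.
have lt k : (k <= 4)%N -> (p + k < 6)%N by case: p; lia.
have o k : ~~ odd k -> odd (p + k) = p by move=> /negPf e; rewrite oddD e oddb addbF.
have := hu p (p + 2)%N; have := hu p (p + 4)%N; have := hu (p + 2)%N (p + 4)%N.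
have := hv p (p + 2)%N; have := hv p (p + 4)%N; have := hv (p + 2)%N (p + 4)%N.
have -> : (p < p + 2 < 6)%N by rewrite lt // andbT; lia.
have -> : (p < p + 4 < 6)%N by rewrite lt // andbT; lia.
have -> : (p + 2 < p + 4 < 6)%N by rewrite lt // andbT; lia.
move=> /(_ isT) v1 /(_ isT) v2 /(_ isT) v3 /(_ isT) u1 /(_ isT) u2 /(_ isT) u3.
have [g0|n0] := boolP (~~ (L %| u p)%N && ~~ (L %| v p)%N).
  by case/andP: g0 => *; exists p; split=> //; rewrite -[nat_of_bool p]addn0 ?lt ?o.
have [g2|n2] := boolP (~~ (L %| u (p + 2))%N && ~~ (L %| v (p + 2))%N).
  by case/andP: g2 => *; exists (p + 2)%N; rewrite lt // o.
have [g4|n4] := boolP (~~ (L %| u (p + 4))%N && ~~ (L %| v (p + 4))%N).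
  by case/andP: g4 => *; exists (p + 4)%N; rewrite lt // o.
move: n0 n2 n4 v1 v2 v3 u1 u2 u3.
move: (L %| u p)%N (L %| u (p + 2))%N (L %| u (p + 4))%N.
move: (L %| v p)%N (L %| v (p + 2))%N (L %| v (p + 4))%N.
by do 6 case.
Qed.

Definition E_token q t n e := match e with
  | TokY => base (RelE q t) n = (1%N, y^-1)
  | TokT => base (RelE q t) n = (q.+2, t)
  | TokBit e => base (RelE q t) n = (0%N, gamma (if e then a else b))
  | TokWild => exists g, base (RelE q t) n = (0%N, gamma g)
  end.

Lemma E_tokenP q t n : E_token q t n (tok m bit n).
Proof.
rewrite /tok /slot_token odd_modL; have [o|e] := boolP (odd n).
  case: ifP => /= [_|]; first by eexists; rewrite base_odd.
  by rewrite base_odd //= => /norP[/negPf -> /negPf ->].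
have := base_even (RelE q t) e => /=.
move: (odd_modL n) (odd_double_half (n %% L)); rewrite (negPf e) => -> /=.
by rewrite add0n => <-; rewrite doubleK double_eq0; case: ifP.
Qed.

Lemma E_compat q q' t t' n n' : base (RelE q t) n = base (RelE q' t') n' ->
  compat (tok m bit n) (tok m bit n').
Proof.
have := E_tokenP q t n; have := E_tokenP q' t' n'.
case: (tok m bit n) => [||e|]; case: (tok m bit n') => [||e'|] //=;
  try (move=> -> -> //); try (move=> [g ->] -> //); try (by move=> -> [g ->]).
move=> -[] /gamma_inj; case: e; case: e' => // /eqP; first by rewrite (negPf ab).
by rewrite eq_sym (negPf ab).
Qed.

Lemma E_inv_compat q q' t t' n n' :
  base (RelE q' t') n' = linv (base (RelE q t) n) ->
  inv_compat (a^-1 == b) (tok m bit n') (tok m bit n).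
Proof.
rewrite /linv; have := E_tokenP q t n; have := E_tokenP q' t' n'.
case: (tok m bit n) => [||e|]; case: (tok m bit n') => [||e'|] //=;
  try (move=> -> -> //); try (move=> [g ->] -> //); try (by move=> -> [g ->]).
- by rewrite invgK => -[] e; have := @y_inv 1 1 (esym e).
- rewrite -multiplicativeV => -[] /gamma_inj.
  case: e; case: e' => /= e; apply/eqP; symmetry.
  + by rewrite -e (negPf ab).
  + by rewrite e eqxx.
  + by rewrite e invgK eqxx.
  + by apply: contraNF ab => /eqP h; rewrite e -h invgK.
Qed.

Lemma far_add i s t : (s < t < 6)%N -> ~~ ((L %| i + s)%N && (L %| i + t)%N).
Proof. by move=> lt; apply: dvdn_far; lia. Qed.

Lemma far_sub i s t : (s < t < 6)%N ->
  ~~ ((L %| i + (K.-1 - s))%N && (L %| i + (K.-1 - t))%N).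
Proof. by move=> lt; rewrite andbC; apply: dvdn_far; lia. Qed.

Lemma half_modL i j : ~~ odd i -> ~~ odd j -> (i %% L)./2 = (j %% L)./2 ->
  i = j %[mod L].
Proof.
move=> oi oj e; rewrite -[LHS]odd_double_half -[RHS]odd_double_half e.
by rewrite !odd_modL (negPf oi) (negPf oj).
Qed.

(** A coded exponent in a common position determines the kind of the relator and the position; the
    next element of [G] determines [h]. *)
Lemma piece_coded r r' i i' o : coded r = Some o ->
  (forall t, (t < K)%N -> base r (i + t) = base r' (i' + t)) ->
  r = r' /\ i = i' %[mod L].
Proof.
move=> cr h.
have [t [lt ot nz nz']] := find_position (odd i) (far_add i) (far_add i').
have e := h t ltac:(lia).
have ev : ~~ odd (i + t) by rewrite oddD ot addbb.
have ev' : ~~ odd (i' + t) by rewrite -(base_slot r') -e base_slot.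
rewrite (coded_letter cr) // in e.
case cr' : (coded r') => [o'|]; last first.
  case: r' cr' e {h ev'} => // q' t' _ e.
  have k2 : (2 <= code o ((i + t) %% L)./2)%N by [].
  by have [] := uncoded_letter q' t' (i' + t) k2; rewrite -e.
rewrite (coded_letter cr') // in e.
case: e => /y_inj /code_inj [eo /(half_modL ev ev') em].
have ei : i = i' %[mod L] by apply/eqP; rewrite -(eqn_modDr t); apply/eqP.
split=> //; rewrite -{}eo in cr'.
case: r r' cr cr' h {ev ev' em nz nz'} => [g|q|//] [g'|q'|//] [<-] // e h; last first.
  by case: e => ->.
have := h t.+1 ltac:(lia).
have o1 : odd (i + t.+1) by rewrite addnS /= oddD ot addbb.
have o1' : odd (i' + t.+1) by rewrite -odd_modL -modnDml -ei modnDml odd_modL.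
rewrite !base_odd //= => -[/gamma_inj].
have -> : ((i' + t.+1) %% L = (i + t.+1) %% L)%N by rewrite -modnDml -ei modnDml.
by case: odd => [/invg_inj|] ->.
Qed.

Lemma piece r r' i i' :
  (forall t, (t < K)%N -> base r (i + t) = base r' (i' + t)) ->
  r = r' /\ i = i' %[mod L].
Proof.
case cr : (coded r) => [o|]; first exact: piece_coded cr.
case cr' : (coded r') => [o|] h.
  by have [|-> ->] := piece_coded (i := i') (i' := i) cr' (r' := r); first by move=> t /h.
case: r cr h => // q t _ h; case: r' cr' h => // q' t' _ h.
have ei : i = i' %[mod L] by apply: (ap_piece ap) => s /h /E_compat.
have [s [lt os nz nz']] := find_position (odd i) (far_add i) (far_add i').
have := h s ltac:(lia); have ev : ~~ odd (i + s) by rewrite oddD os addbb.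
have ev' : ~~ odd (i' + s) by rewrite -odd_modL -modnDml -ei modnDml odd_modL.
rewrite !base_even //=.
have -> : ((i' + s) %% L = (i + s) %% L)%N by rewrite -modnDml -ei modnDml.
have nz2 : ((i + s) %% L)./2 != 0%N.
  by move: (odd_modL (i + s)) (odd_double_half ((i + s) %% L)); rewrite (negPf ev) => -> /=; lia.
by rewrite (negPf nz2) => -[-> ->].
Qed.

(** Coded exponents are positive, so none of them is the inverse of another one. *)
Lemma inv_piece_coded r r' i i' o : coded r = Some o ->
  ~ (forall t, (t < K)%N -> base r' (i' + t) = linv (base r (i + (K.-1 - t)))).
Proof.
move=> cr h.
have [t [lt ot nz nz']] := find_position (odd (i + K.-1)) (far_sub i) (far_add i').
have e := h t ltac:(lia).
have ev : ~~ odd (i + (K.-1 - t)).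
  by rewrite addnBA; [rewrite oddB ?ot ?addbb //; lia|lia].
have ev' : ~~ odd (i' + t) by rewrite -(base_slot r') e /= base_slot.
rewrite (coded_letter cr) // in e.
case cr' : (coded r') => [o'|]; last first.
  case: r' cr' e {h ev'} => // q' t' _ e.
  have k2 : (2 <= code o ((i + (K.-1 - t)) %% L)./2)%N by [].
  by have [_] := uncoded_letter q' t' (i' + t) k2; rewrite e.
by rewrite (coded_letter cr') // in e; case: e => /y_inv.
Qed.

Lemma inv_piece r r' i i' :
  ~ (forall t, (t < K)%N -> base r' (i' + t) = linv (base r (i + (K.-1 - t)))).
Proof.
case cr : (coded r) => [o|]; first exact: inv_piece_coded cr.
case cr' : (coded r') => [o|] h.
  apply: (inv_piece_coded (i := i') (i' := i) (r' := r) cr') => t lt.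
  have := h (K.-1 - t)%N ltac:(lia); rewrite subKn; last by lia.
  by move=> ->; case: (base r _) => j g; rewrite /linv invgK.
case: r cr h => // q t _ h; case: r' cr' h => // q' t' _ h.
by case: (ap_inv_piece ap (flip := a^-1 == b) (i := i) (j := i')) => s /h /E_inv_compat.
Qed.

Theorem relators_small_cancellation : small_cancellation K L relators.
Proof.
split.
- by split; lia.
- by move=> w [r [i [_ ->]]] n; apply: base_mod; rewrite addnCA modnDl.
- move=> w n [r [i [v ->]]]; rewrite /shift.
  have [o|e] := boolP (odd (i + n)); last by rewrite base_even // aletter_neq1.
  rewrite base_odd //= -(multiplicative1 gamma); apply/eqP => /gamma_inj/eqP.
  by rewrite (negPf (gletter_neq1 _ v)).
- move=> w n [r [i [v ->]]]; rewrite /shift addnS; apply/eqP => e.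
  have := base_slot r (i + n); rewrite e base_slot /=.
  by case: odd.
- move=> w k [r [i [v ->]]]; exists r, (i + k)%N; split=> //.
  by apply/funext => n; rewrite /shift addnA.
- move=> w w' [r [i [v ->]]] [r' [i' [v' ->]]] h.
  by have [<- ei] := piece h; apply: shift_base_mod.
- by move=> w w' [r [i [v ->]]] [r' [i' [v' ->]]]; apply: inv_piece.
Qed.

End Relators.

Local Open Scope classical_set_scope.
Local Open Scope card_scope.
Local Open Scope group_scope.

(** * Simple quotients *)

Definition normal_in (G : groupType) (P N : set G) :=
  [/\ is_subgroup N, N `<=` P & forall x p, N x -> P p -> N (x ^ p)].

Record subquotient (G : groupType) := Subquotient {
  sq_upper : set G;
  sq_lower : set G;
  sq_upperP : is_subgroup sq_upper;
  sq_lowerP : normal_in sq_upper sq_lower }.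

(** The group of the cosets of [sq_lower s] in [sq_upper s]. *)
Section Subquotient.
Variables (G : groupType) (s : subquotient G).
Local Notation P := (sq_upper s).
Local Notation N := (sq_lower s).

Let P1 : P 1. Proof. by case: (sq_upperP s). Qed.
Let PM x y : P x -> P y -> P (x * y). Proof. by case: (sq_upperP s) => _ + _; apply. Qed.
Let PV x : P x -> P x^-1. Proof. by case: (sq_upperP s) => _ _; apply. Qed.
Let N1 : N 1. Proof. by case: (sq_lowerP s) => -[]. Qed.
Let NM x y : N x -> N y -> N (x * y). Proof. by case: (sq_lowerP s) => -[_ + _] _ _; apply. Qed.
Let NV x : N x -> N x^-1. Proof. by case: (sq_lowerP s) => -[_ _ +] _ _; apply. Qed.
Let NJ x p : N x -> P p -> N (x ^ p). Proof. by case: (sq_lowerP s) => _ _; apply. Qed.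

Definition coset x : set G := [set y | N (x^-1 * y)].

Lemma coset_eq x y : coset x = coset y <-> N (x^-1 * y).
Proof.
split=> [e|n]; first by rewrite -[N _]/(coset x y) e /coset /= mulVg.
apply/seteqP; split=> z; rewrite /coset /= => h.
  have -> : y^-1 * z = (x^-1 * y)^-1 * (x^-1 * z) by rewrite invgM invgK -mulgA mulVKg.
  by apply: NM => //; apply: NV.
have -> : x^-1 * z = (x^-1 * y) * (y^-1 * z) by rewrite -mulgA mulVKg.
exact: NM.
Qed.

Definition subquot := {A : set G | exists2 x, P x & A = coset x}.

HB.instance Definition _ := gen_eqMixin subquot.
HB.instance Definition _ := gen_choiceMixin subquot.

(** Total, with the junk value [class 1] outside [P], to avoid membership proofs as
    arguments. *)
Definition class x : subquot :=
  if pselect (P x) is left Px then exist _ (coset x) (ex_intro2 _ _ x Px erefl)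
  else exist _ (coset 1) (ex_intro2 _ _ 1 P1 erefl).

Lemma class_eq x y : P x -> P y -> class x = class y <-> N (x^-1 * y).
Proof.
move=> Px Py; rewrite -coset_eq /class; case: pselect => // px; case: pselect => // py.
by split=> [/(congr1 sval)|e] //=; apply: eq_exist.
Qed.

Definition repr (A : subquot) : G := s2val (cid2 (svalP A)).

Lemma reprP A : P (repr A). Proof. exact: (s2valP (cid2 (svalP A))). Qed.

Lemma reprK A : class (repr A) = A.
Proof.
have e := s2valP' (cid2 (svalP A)); rewrite /class; case: pselect (reprP A) => // px _.
by case: A e px => C PC e px; apply: eq_exist.
Qed.

Lemma class_surj A : exists2 x, P x & class x = A.
Proof. by exists (repr A); [exact: reprP|exact: reprK]. Qed.

Definition sq_mul A B := class (repr A * repr B).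
Definition sq_inv A := class (repr A)^-1.

Lemma repr_class x : P x -> N ((repr (class x))^-1 * x).
Proof. by move=> Px; rewrite -class_eq ?reprK //; exact: reprP. Qed.

Lemma sq_mulE x y : P x -> P y -> sq_mul (class x) (class y) = class (x * y).
Proof.
move=> Px Py; have := repr_class Px; have := repr_class Py.
have := reprP (class x); have := reprP (class y); rewrite /sq_mul.
move: (repr (class x)) (repr (class y)) => x' y' Py' Px' ny nx.
apply/class_eq; [exact: PM|exact: PM|].
have -> : (x' * y')^-1 * (x * y) = (x'^-1 * x) ^ y' * (y'^-1 * y).
  by rewrite invgM /conjg -!mulgA mulVKg.
by apply: NM => //; apply: NJ.
Qed.

Lemma sq_invE x : P x -> sq_inv (class x) = class x^-1.
Proof.
move=> Px; have := repr_class Px; have := reprP (class x); rewrite /sq_inv.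
move: (repr _) => x' Px' nx; apply/class_eq; [exact: PV|exact: PV|].
rewrite invgK -invgF; apply: NV.
by have := NJ nx (PV Px); rewrite /conjg invgK -!mulgA mulgV mulg1.
Qed.

Lemma sq_mulA : associative sq_mul.
Proof.
move=> A B C; have [x Px <-] := class_surj A; have [y Py <-] := class_surj B.
have [z Pz <-] := class_surj C; rewrite !sq_mulE ?mulgA //; exact: PM.
Qed.

Lemma sq_mul1 : left_id (class 1) sq_mul.
Proof. by move=> A; have [x Px <-] := class_surj A; rewrite sq_mulE ?mul1g. Qed.

Lemma sq_mulr1 : right_id (class 1) sq_mul.
Proof. by move=> A; have [x Px <-] := class_surj A; rewrite sq_mulE ?mulg1. Qed.

Lemma sq_mulV : left_inverse (class 1) sq_inv sq_mul.
Proof.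
move=> A; have [x Px <-] := class_surj A; rewrite sq_invE // sq_mulE ?mulVg //.
exact: PV.
Qed.

Lemma sq_mulrV : right_inverse (class 1) sq_inv sq_mul.
Proof.
move=> A; have [x Px <-] := class_surj A; rewrite sq_invE // sq_mulE ?mulgV //.
exact: PV.
Qed.

HB.instance Definition _ :=
  isGroup.Build subquot sq_mulA sq_mul1 sq_mulr1 sq_mulV sq_mulrV.

Lemma classM x y : P x -> P y -> class (x * y) = class x * class y.
Proof. by move=> Px Py; rewrite -sq_mulE. Qed.

Lemma classV x : P x -> class x^-1 = (class x)^-1.
Proof. by move=> Px; rewrite -sq_invE. Qed.

Lemma classX x k : P x -> class (x ^+ k) = class x ^+ k.
Proof.
move=> Px; elim: k => [//|k IH]; rewrite !expgS -IH -classM //.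
by elim: k {IH} => [//|k IH]; rewrite expgS; apply: PM.
Qed.

Lemma class_eq1 x : P x -> class x = 1 <-> N x.
Proof.
move=> Px; rewrite -[X in N X]mul1g -[X in N (X * _)]invg1 -class_eq //.
by split=> e; exact: esym e.
Qed.

End Subquotient.

(** Zorn's lemma for the sets that become such a normal subgroup when [1] is added: these include
    the empty set, which is the union of the empty chain. *)
Lemma maximal_normal (G : groupType) (P : set G) (y : G) :
  is_subgroup P -> y <> 1 -> exists N, [/\ normal_in P N, ~ N y &
    forall M, normal_in P M -> N `<=` M -> ~ M y -> M `<=` N].
Proof.
move=> [P1 PM PV] y1.
pose with1 (A : set G) := A `|` [set 1].
pose Q (A : set G) := normal_in P (with1 A) /\ ~ with1 A y.
have [A [[nA nAy] maxA]] : exists A, Q A /\ forall B, A `<` B -> ~ Q B.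
  apply: Zorn_bigcup => F FQ tot; split; last first.
    by case=> [[A /FQ[_ nAy] Ay]|//]; apply: nAy; left.
  split; first split.
  - by right.
  - have sub A : F A -> with1 A `<=` with1 (\bigcup_(X in F) X).
      by move=> FA x [Ax|]; [left; exists A|right].
    move=> x z [[A FA Ax]|->]; last by rewrite mul1g.
    move=> [[B FB Bz]|->]; last by rewrite mulg1; left; exists A.
    have both C : F C -> C x -> C z -> with1 (\bigcup_(X in F) X) (x * z).
      move=> FC Cx Cz; apply: (sub _ FC).
      by have [[[_ mulC _] _ _] _] := FQ _ FC; apply: mulC; left.
    have [le|le] := tot _ _ FA FB; first by apply: (both B) => //; apply: le.
    by apply: (both A) => //; apply: le.
  - move=> x [[A FA Ax]|->]; last by rewrite invg1; right.
    have [[[_ _ invA] _ _] _] := FQ _ FA.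
    by have [AV|->] := invA x (or_introl Ax); [left; exists A|right].
  - move=> x [[A FA Ax]|-> //]; have [[_ sub _] _] := FQ _ FA.
    by apply: sub; left.
  - move=> x p [[A FA Ax]|->] Pp; last by right; rewrite /= /conjg mul1g mulVg.
    have [[_ _ conjA] _] := FQ _ FA.
    by have [AJ|->] := conjA x p (or_introl Ax) Pp; [left; exists A|right].
exists (with1 A); split=> // M nM sub My x Mx.
apply: contrapT => nx; apply: (maxA M).
  split; first by move=> z Az; apply: sub; left.
  by move=> /(_ x Mx) Ax; apply: nx; left.
have e : with1 M = M.
  by apply/seteqP; split=> [z [//|->]|z Mz]; [by case: nM => -[]|left].
by rewrite /Q e.
Qed.

(** [ambient] is the group [P] of the introduction. *)
Section SimpleQuotient.
Variables (G H : groupType) (X : {multiplicative G -> H}) (Y : H) (Z : nat -> H).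

Definition ambient := generated_subgroup (range X `|` [set Y]).

Lemma generated_is_subgroup (T : groupType) (A : set T) :
  is_subgroup (generated_subgroup A).
Proof.
split=> [M [[M1 _ _] _] //|x y gx gy M AM|x gx M AM].
- by have [[_ MM _] _] := AM; apply: MM; [apply: gx|apply: gy].
- by have [[_ _ MV] _] := AM; apply: MV; apply: gx.
Qed.

Lemma ambientX h : ambient (X h).
Proof. by move=> M [_ sub]; apply: sub; left; exists h. Qed.

Lemma ambientY : ambient Y.
Proof. by move=> M [_ sub]; apply: sub; right. Qed.

Lemma ambient_sub M : is_subgroup M -> (forall h, M (X h)) -> M Y -> ambient `<=` M.
Proof. by move=> sM MX MY x; apply; split=> // _ [[h _ <-]|->]. Qed.

Hypothesis Y1 : Y <> 1.
Hypothesis PZ : forall q, ambient (Z q).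
Hypothesis killX : forall N, normal_in ambient N ->
  forall h, h <> 1 -> N (X h) -> N Y.
Hypothesis killY : forall N, normal_in ambient N -> N Y -> forall h, N (X h).
Hypothesis killZ : forall N, normal_in ambient N ->
  forall q k, Z q ^+ k <> 1 -> N (Z q ^+ k) -> N Y.
Hypothesis genZ : forall M, is_subgroup M -> (forall h, M (X h)) ->
  forall q, Z q <> 1 -> M (Z q) -> M Y.

Theorem simple_quotient : exists (S : groupType) (phi : {multiplicative G -> S}),
  [/\ is_simple S, injective phi & forall q, Z q <> 1 -> exists z : S,
    (forall k, z ^+ k = 1 <-> Z q ^+ k = 1) /\
    generated_subgroup (range phi `|` [set z]) = [set: S]].
Proof.
have sP : is_subgroup ambient := generated_is_subgroup _.
have [P1 PM PV] := sP.
have [N [nN nNY maxN]] := maximal_normal sP Y1.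
have [[N1 NM NV] sub NJ] := nN.
pose s := Subquotient sP nN; pose S := subquot s.
pose cl : H -> S := @class H s.
have clM x y : ambient x -> ambient y -> cl (x * y) = cl x * cl y by exact: (@classM H s x y).
have clV x : ambient x -> cl x^-1 = (cl x)^-1 by exact: (@classV H s x).
have clX x k : ambient x -> cl (x ^+ k) = cl x ^+ k by exact: (@classX H s x k).
have cl1 x : ambient x -> cl x = 1 <-> N x by exact: (@class_eq1 H s x).
have surj A : exists2 x, ambient x & cl x = A by exact: (class_surj A).
have PX x k : ambient x -> ambient (x ^+ k).
  by move=> Px; elim: k => [//|k IH]; rewrite expgS; apply: PM.
pose phi h := cl (X h).
have phiM : {morph phi : x y / x * y}.
  by move=> x y; rewrite /phi gmulfM clM //; exact: ambientX.
pose phi_mixin := isMultiplicative.Build G S phi phiM.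
pose phi' : {multiplicative G -> S} := HB.pack phi phi_mixin.
exists S, phi'.
have preim_sub (M : set S) : is_subgroup M -> is_subgroup [set x | ambient x /\ M (cl x)].
  move=> [M1 MM MV]; split=> [|x y [Px Mx] [Py My]|x [Px Mx]].
  - have e1 : cl 1 = 1 by apply/cl1.
    by split=> //=; rewrite e1.
  - by split; rewrite ?clM; [exact: PM|exact: MM| |].
  - by split; rewrite ?clV; [exact: PV|exact: MV|].
split.
- split.
    move=> e; apply: nNY; apply/cl1; first exact: ambientY.
    by have : [set: S] (cl Y) by []; rewrite e.
  move=> M [sM MJ].
  have nM : normal_in ambient [set x | ambient x /\ M (cl x)].
    split; [exact: preim_sub|by move=> x []|move=> x p [Px Mx] Pp].
    have Pp' := PV p Pp.
    split; rewrite /conjg ?clM ?clV //; [|exact: MJ|]; try exact: PM.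
    by apply: (PM _ _ Pp'); exact: PM.
  have [MY|nMY] := pselect (M (cl Y)).
    right; apply/seteqP; split=> // A _; have [x Px <-] := surj A.
    have nMY : [set x | ambient x /\ M (cl x)] Y by split=> //; exact: ambientY.
    have [sM' _ _] := nM.
    by have [] := ambient_sub sM' (killY nM nMY) nMY Px.
  left; apply/seteqP; split=> [A MA|_ ->]; last by case: sM.
  have [x Px e] := surj A; rewrite -e in MA *; apply/cl1 => //.
  apply: (maxN _ nM) => // [n Nn|[_ //]].
  have e1 : cl n = 1 by apply/cl1 => //; exact: sub.
  by split; [exact: sub|rewrite e1; case: sM].
- move=> x y e; apply: contrapT => ne; apply: nNY; apply: (killX nN (h := x * y^-1)).
    by move=> e1; apply: ne; rewrite -(mulgVK y x) e1 mul1g.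
  apply/cl1; first exact: ambientX.
  have : phi x = phi y by [].
  rewrite gmulfM multiplicativeV /phi => e'.
  by rewrite clM ?clV ?e' ?mulgV //; try apply: PV; apply: ambientX.
- move=> q Zq; exists (cl (Z q)); split=> [k|].
    rewrite -clX //; split=> [/cl1|->]; last exact/cl1.
    move=> h; apply: contrapT => ne; apply: nNY; apply: (killZ nN ne).
    by apply: h; exact: PX.
  apply/seteqP; split=> // A _ M [sM sub'].
  have [x Px <-] := surj A.
  have sM' := preim_sub M sM.
  have MX h : [set x | ambient x /\ M (cl x)] (X h).
    by split; [exact: ambientX|apply: sub'; left; exists h].
  have MZ : [set x | ambient x /\ M (cl x)] (Z q) by split=> //; apply: sub'; right.
  by have [] := ambient_sub sM' MX (genZ sM' MX Zq MZ) Px.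
Qed.

End SimpleQuotient.

(** * Groups of bijections *)

Record bijection (T : Type) := Bijection {
  bij_fun :> T -> T;
  bij_inv : T -> T;
  bijK : cancel bij_fun bij_inv;
  bijVK : cancel bij_inv bij_fun }.

Section Bijections.
Variable T : Type.
Implicit Types f g : bijection T.

Lemma bij_ext f g : f =1 g -> f = g.
Proof.
case: f g => [f f' fK f'K] [g g' gK g'K] /= /funext e.
rewrite -{}e in gK g'K *; have e' : f' = g'.
  by apply/funext => x; rewrite -[x in LHS]g'K fK.
by rewrite -{}e' in gK g'K *; congr Bijection; exact: Prop_irrelevance.
Qed.

HB.instance Definition _ := gen_eqMixin (bijection T).
HB.instance Definition _ := gen_choiceMixin (bijection T).

Definition bij_one : bijection T := @Bijection T id id (fun=> erefl) (fun=> erefl).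
Definition bij_mul f g : bijection T :=
  Bijection (can_comp (bijK f) (bijK g)) (can_comp (bijVK g) (bijVK f)).
Definition bij_V f : bijection T := Bijection (bijVK f) (bijK f).

Let bij_mulA : associative bij_mul. Proof. by move=> f g h; exact: bij_ext. Qed.
Let bij_mul1 : left_id bij_one bij_mul. Proof. by move=> f; exact: bij_ext. Qed.
Let bij_mulr1 : right_id bij_one bij_mul. Proof. by move=> f; exact: bij_ext. Qed.
Let bij_mulV : left_inverse bij_one bij_V bij_mul.
Proof. by move=> f; apply: bij_ext => x; exact: bijK. Qed.
Let bij_mulrV : right_inverse bij_one bij_V bij_mul.
Proof. by move=> f; apply: bij_ext => x; exact: bijVK. Qed.

HB.instance Definition _ :=
  isGroup.Build (bijection T) bij_mulA bij_mul1 bij_mulr1 bij_mulV bij_mulrV.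

Lemma bijM f g x : (f * g) x = f (g x). Proof. by []. Qed.
Lemma bij1 x : (1 : bijection T) x = x. Proof. by []. Qed.

End Bijections.

(** * The group of letters *)

(** A group that contains [G] and elements of all orders: [G] translates the left summand, and
    the right summand contains for every [n] a row with a cycle of length [n]. Rotating the
    row [q] has order [q]; rotating all rows has infinite order. *)
Section Letters.
Variable G : groupType.

Definition points := (G + nat * nat)%type.

Definition translate_fun (h : G) (x : points) : points :=
  if x is inl g then inl (h * g) else x.

Lemma translateK h : cancel (translate_fun h) (translate_fun h^-1).
Proof. by case=> [g|] //=; rewrite mulKg. Qed.

Lemma translateVK h : cancel (translate_fun h^-1) (translate_fun h).
Proof. by case=> [g|] //=; rewrite mulVKg. Qed.

Definition translate h : bijection points := Bijection (translateK h) (translateVK h).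

Lemma translateM : {morph translate : x y / x * y}.
Proof. by move=> x y; apply: bij_ext => -[g|//] /=; rewrite mulgA. Qed.

HB.instance Definition _ := isMultiplicative.Build G (bijection points) translate translateM.

Lemma translate_inj : injective translate.
Proof.
by move=> x y /(congr1 (fun f : bijection points => f (inl 1))) [] /=; rewrite !mulg1.
Qed.

Definition rotate_fun (D : pred nat) s (x : points) : points :=
  if x is inr (n, k) then
    inr (n, if D n && (k < n)%N then ((k + s n) %% n)%N else k)
  else x.

Lemma rotate_can D s s' : (forall n, (0 < n)%N -> n %| s n + s' n)%N ->
  cancel (rotate_fun D s) (rotate_fun D s').
Proof.
move=> dv [//|[n k]] /=; case: (D n) => //=; case: (ltnP k n) => [lt|le]; last by rewrite ltnNge le.
have n0 : (0 < n)%N by lia.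
by rewrite ltn_mod n0 modnDml -addnA -modnDmr (eqP (dv n n0)) addn0 modn_small.
Qed.

Lemma rotateK D : cancel (rotate_fun D (fun=> 1%N)) (rotate_fun D predn).
Proof. by apply: rotate_can => n n0; rewrite add1n prednK. Qed.

Lemma rotateVK D : cancel (rotate_fun D predn) (rotate_fun D (fun=> 1%N)).
Proof. by apply: rotate_can => n n0; rewrite addn1 prednK. Qed.

Definition rotate D : bijection points := Bijection (rotateK D) (rotateVK D).

Lemma rotateX D j : (rotate D ^+ j : bijection points) =1 rotate_fun D (fun=> j).
Proof.
elim: j => [|j IH] x.
  case: x => [//|[n k]] /=; rewrite addn0.
  by case: ifP => // /andP[_ lt]; rewrite modn_small.
rewrite expgS bijM IH; case: x => [//|[n k]] /=; case: (D n) => //=.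
case: (ltnP k n) => [lt|le]; last by rewrite ltnNge le.
by rewrite ltn_mod (leq_ltn_trans _ lt) // modnDml -addnA addn1.
Qed.

Lemma rotateX_eq1 D j : rotate D ^+ j = 1 <-> forall n, D n -> (0 < n)%N -> (n %| j)%N.
Proof.
split=> [e n Dn n0|dv].
  have := rotateX D j (inr (n, 0%N)); rewrite e /= Dn n0 /= => -[/esym/eqP].
  by rewrite add0n.
apply: bij_ext => x; rewrite rotateX; case: x => [//|[n k]] /=.
case Dn : (D n) => //=; case: ltnP => // lt.
by rewrite -modnDmr (eqP (dv n Dn _)) ?addn0 ?modn_small //; lia.
Qed.

Definition stable_letter : bijection points := rotate predT.
Definition cyclic_letter q : bijection points :=
  if q == 0%N then stable_letter else rotate (pred1 q).

Lemma stable_letter_inf j : stable_letter ^+ j = 1 -> j = 0%N.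
Proof.
move=> /rotateX_eq1 /(_ j.+1 isT isT) dv.
by apply/eqP; case: j dv => // j /dvdn_leq; rewrite ltnn => /(_ isT).
Qed.

Lemma cyclic_letterX_eq1 q j : (0 < q)%N -> cyclic_letter q ^+ j = 1 <-> (q %| j)%N.
Proof.
rewrite /cyclic_letter lt0n => q0; rewrite (negPf q0) rotateX_eq1.
by split=> [/(_ q)|dv n /eqP -> //]; rewrite /= eqxx lt0n; apply.
Qed.

End Letters.

(** * Evaluation of the relators *)

Section AlternatingProduct.
Variable H : groupType.
Implicit Types A B : nat -> H.

(** The factors of later letters stand on the left, since bijections compose that way. *)
Fixpoint altprod A B n := if n is n'.+1 then B n' * (A n' * altprod A B n') else 1.

Lemma altprodS A B n : altprod A B n.+1 = B n * (A n * altprod A B n).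
Proof. by []. Qed.

Lemma altprod_last (M : set H) A B n : is_subgroup M -> (0 < n)%N ->
  (forall i, (i < n)%N -> M (B i)) -> (forall i, (0 < i < n)%N -> M (A i)) ->
  altprod A B n = 1 -> M (A 0%N).
Proof.
move=> [M1 MM MV] n0 MB MA e.
have sub : forall k, (k < n)%N -> M (altprod A B k.+1 * (A 0%N)^-1).
  elim=> [|k IH] lt; first by rewrite /= mulg1 mulgK; apply: MB.
  rewrite altprodS -(mulgA (B _)) -(mulgA (A _)); apply: (MM); first exact: MB.
  by apply: (MM); [apply: MA|apply: IH; lia].
have := sub n.-1; rewrite prednK // e mul1g => h.
by rewrite -[A _]invgK; apply/MV/h; lia.
Qed.

Lemma altprod_congr (P N : set H) A B A' B' n : is_subgroup P -> normal_in P N ->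
  (forall i, (i < n)%N -> [/\ P (A i), P (B i), N (A i * (A' i)^-1) & N (B i * (B' i)^-1)]) ->
  N (altprod A B n * (altprod A' B' n)^-1).
Proof.
move=> [P1 PM PV] [[N1 NM NV] _ NJ].
have mul x y x' y' : P x -> N (x * x'^-1) -> N (y * y'^-1) -> N (x * y * (x' * y')^-1).
  move=> Px nx ny; have -> : x * y * (x' * y')^-1 = (y * y'^-1) ^ x^-1 * (x * x'^-1).
    by rewrite invgM /conjg invgK -!mulgA mulKg.
  by apply: (NM) => //; apply: NJ => //; apply: PV.
elim: n => [|n IH] h; first by rewrite /= mulgV.
have [PA PB nA nB] := h n (leqnn _).
apply: (mul) => //; apply: (mul) => //; apply: IH => i lt; apply: h; exact: ltnW.
Qed.

End AlternatingProduct.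

Section DescendingProduct.
Variable H : groupType.
Implicit Types (A B : nat -> H) (x : H).

Fixpoint gprod A n := if n is n'.+1 then A n' * gprod A n' else 1.

Lemma eq_gprod A B n : (forall i, (i < n)%N -> A i = B i) -> gprod A n = gprod B n.
Proof.
elim: n => [//|n IH] e /=; rewrite e // IH // => i lt.
by apply: e; exact: ltnW.
Qed.

Lemma gprod_head A n : gprod A n.+1 = gprod (fun i => if i == 0%N then 1 else A i) n.+1 * A 0%N.
Proof.
elim: n => [|n IH]; first by rewrite /= !mulg1 mul1g.
by rewrite -[LHS]/(A n.+1 * gprod A n.+1) IH mulgA.
Qed.

Lemma altprod_B1 A n : altprod A (fun=> 1) n = gprod A n.
Proof. by elim: n => [//|n IH] /=; rewrite IH mul1g. Qed.

Lemma altprod_A1 B n : altprod (fun=> 1) B n = gprod B n.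
Proof. by elim: n => [//|n IH] /=; rewrite IH mul1g. Qed.

Lemma altprod_head x B n :
  altprod (fun i => if i == 0%N then x else 1) B n.+1 = gprod B n.+1 * x.
Proof.
elim: n => [|n IH]; first by rewrite /= !mulg1.
by rewrite altprodS IH /= mul1g !mulgA.
Qed.

End DescendingProduct.

Lemma gprodM (G H : groupType) (f : {multiplicative G -> H}) A n :
  f (gprod A n) = gprod (fun i => f (A i)) n.
Proof. by elim: n => [|n IH] /=; rewrite ?multiplicative1 // gmulfM IH. Qed.

(** * The embedding *)

Section LimitGroup.
Variables (B : groupType) (K L : nat) (R : word B -> Prop).
Hypothesis sc : small_cancellation K L R.
Local Notation lim := (limit K L R).

Definition letter_bij i b : bijection (point B) :=
  Bijection (actK (limit_good sc) i b) (actVK (limit_good sc) i b).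

Lemma letter_bijM i b c : letter_bij i (b * c) = letter_bij i b * letter_bij i c.
Proof. by apply: bij_ext => u; exact: (actM (limit_good sc)). Qed.

HB.instance Definition _ i :=
  isMultiplicative.Build B (bijection (point B)) (letter_bij i) (letter_bijM i).

Lemma letter_bij_eq1 i b : letter_bij i b = 1 -> b = 1.
Proof.
move=> e; apply: (act_free (limit_good sc) (i := i) (u := Root B)) => //.
exact: (congr1 (fun f : bijection (point B) => f (Root B)) e).
Qed.

End LimitGroup.

Section Embedding.
Variables (G B : groupType) (gamma : {multiplicative G -> B}).
Variables (y : B) (zeta : nat -> B) (a b c d : G).
Variables (m K : nat) (bit : nat -> bool).
Hypotheses (K7 : (7 <= K)%N) (Km : (7 * K <= m)%N) (mo : odd m).
Hypothesis gamma_inj : injective gamma.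
Hypothesis y_inf : forall n, y ^+ n = 1 -> n = 0%N.
Hypotheses (a1 : a != 1) (b1 : b != 1) (c1 : c != 1) (d1 : d != 1) (ab : a != b).
Hypothesis ap : aperiodic m bit K.

Local Notation rel := (relator G B).
Local Notation glet := (gletter (B:=B) a b c d m bit).
Local Notation alet := (aletter (G:=G) y zeta m).
Hypothesis cd : forall q t, gprod (glet (RelE G q t)) m = 1.

Let R := relators gamma y zeta a b c d m bit.
Let sc : small_cancellation K m.*2 R :=
  relators_small_cancellation zeta K7 Km gamma_inj y_inf a1 b1 c1 d1 ab ap.

Let X_fun h := letter_bij sc 0 (gamma h).
Let X_funM : {morph X_fun : g h / g * h}.
Proof. by move=> g h; rewrite /X_fun gmulfM letter_bijM. Qed.
HB.instance Definition _ := isMultiplicative.Build G (bijection (point B)) X_fun X_funM.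
Let X : {multiplicative G -> bijection (point B)} := X_fun.
Let Y : bijection (point B) := letter_bij sc 1 y.
Let Z q : bijection (point B) := letter_bij sc q.+2 (zeta q).
Let P := ambient X Y.

Let Abij (r : rel) i := letter_bij sc (alet r i).1 (alet r i).2.
Let Bbij (r : rel) i : bijection (point B) := X (glet r i).

Lemma relator_altprod r : valid zeta r -> altprod (Abij r) (Bbij r) m = 1.
Proof.
move=> v; apply: bij_ext => u.
have Rr : R (base gamma y zeta a b c d m bit r).
  by exists r, 0%N; split=> //; apply/funext => n.
rewrite bij1 -[RHS](limit_relator sc u Rr).
suff h n : (n <= m)%N -> pos (limit K m.*2 R) (base gamma y zeta a b c d m bit r) u n.*2 =
    altprod (Abij r) (Bbij r) n u by rewrite h.
elim: n => [//|n IH] lt; rewrite doubleS !posS altprodS !bijM -IH; last by lia.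
have e1 : (n.*2 %% m.*2 = n.*2)%N by rewrite modn_small //; lia.
have e2 : (n.*2.+1 %% m.*2 = n.*2.+1)%N by rewrite modn_small //; lia.
by rewrite /base e1 e2 /= odd_double /= doubleK uphalf_double.
Qed.

Let sP : is_subgroup P. Proof. exact: generated_is_subgroup. Qed.

Let subgroupX (M : set (bijection (point B))) x k : is_subgroup M -> M x -> M (x ^+ k).
Proof.
move=> [M1 MM _] Mx; elim: k => [//|k IH]; rewrite expgS.
exact: MM.
Qed.

Let letter_bijX i g k : letter_bij sc i (g ^+ k) = letter_bij sc i g ^+ k.
Proof.
elim: k => [|k IH]; first by rewrite multiplicative1.
by rewrite !expgS letter_bijM IH.
Qed.

Let letter_bijV i g : letter_bij sc i g^-1 = (letter_bij sc i g)^-1.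
Proof. exact: multiplicativeV. Qed.

Let Y1 : Y <> 1.
Proof. by move=> /letter_bij_eq1 e; have := y_inf (n := 1%N) e. Qed.

Let Z_eq1 q : Z q = 1 <-> zeta q = 1.
Proof. by split=> [/letter_bij_eq1 //|e]; rewrite /Z e multiplicative1. Qed.

Let m0 : (0 < m)%N. Proof. by case: m mo. Qed.

Let genY (M : set (bijection (point B))) : is_subgroup M -> (forall h, M (X h)) ->
  forall q, Z q <> 1 -> M (Z q) -> M Y.
Proof.
move=> sM MX q Zq MZ; have [_ _ MV] := sM.
have v : valid zeta (RelE G q (zeta q)) by apply/eqP => /Z_eq1.
have := altprod_last sM m0 _ _ (relator_altprod v).
rewrite /Abij /= letter_bijV => h; rewrite -[Y]invgK; apply: MV.
apply: h => [i _|i /andP[i0 _]]; first exact: MX.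
by rewrite gtn_eqF.
Qed.

Let PZ q : P (Z q).
Proof.
have [_ _ PV] := sP; have [e|ne] := pselect (Z q = 1); first by rewrite e; case: sP.
have v : valid zeta (RelF G B q) by apply/eqP => /Z_eq1.
have := altprod_last sP m0 _ _ (relator_altprod v).
rewrite /Abij /= letter_bijV => h; rewrite -[Z q]invgK; apply: PV.
apply: h => [i _|i /andP[i0 _]]; first exact: (@ambientX _ _ X Y).
rewrite gtn_eqF //= letter_bijX; apply: (subgroupX (M := P)) => //.
exact: (@ambientY _ _ X Y).
Qed.

Let P_Abij_G h i : P (Abij (RelG B h) i).
Proof.
have [_ _ PV] := sP.
have PYk k : P (letter_bij sc 1 (y ^+ k)).
  by rewrite letter_bijX; apply: (subgroupX (M := P)) => //; exact: (@ambientY _ _ X Y).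
by rewrite /Abij /=; case: ifP => _ //; rewrite letter_bijV; apply: PV.
Qed.

Let gprod_Abij h : gprod (Abij (RelG B h)) m = Y.
Proof.
have e n : gprod (Abij (RelG B h)) n.+1 =
    Y ^+ (\sum_(1 <= i < n.+1) code None i) * Abij (RelG B h) 0.
  elim: n => [|n IH]; first by rewrite big_geq //= mulg1 mul1g.
  rewrite -[LHS]/(Abij (RelG B h) n.+1 * gprod (Abij (RelG B h)) n.+1) IH.
  have -> : (\sum_(1 <= i < n.+2) code None i =
      code None n.+1 + \sum_(1 <= i < n.+1) code None i)%N.
    by rewrite big_nat_recr // addnC.
  rewrite expgnDr mulgA; congr (_ * _ * _).
  by rewrite /Abij /= letter_bijX.
rewrite -(prednK m0) e prednK // -[(\sum_(_ <= _ < _) _)%N]/(code_sum m None).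
rewrite /Abij /= letter_bijV letter_bijX.
have := code_sum_gt1 K7 Km None; case: (code_sum m None) => [//|T] _.
by rewrite expgS mulgK.
Qed.

Let gprod_Bbij h : gprod (Bbij (RelG B h)) m = X h.
Proof.
rewrite -gprodM; congr (X _).
have e n : gprod (glet (RelG B h)) n = if odd n then h else 1.
  elim: n => [//|n IH] /=; rewrite IH.
  by case: odd => /=; rewrite ?mulVg ?mulg1.
by rewrite e mo.
Qed.

(** If [X h] is killed, [RelG h] becomes the product of its powers of [Y], which is [Y]. *)
Let killX N : normal_in P N -> forall h, h <> 1 -> N (X h) -> N Y.
Proof.
move=> nN h h1 Nh; have [[N1 NM NV] _ _] := nN.
have v : valid zeta (RelG B h) by apply/eqP.
have := altprod_congr (A := Abij (RelG B h)) (A' := Abij (RelG B h))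
  (B := Bbij (RelG B h)) (B' := fun=> 1) (n := m) sP nN.
rewrite relator_altprod // altprod_B1 gprod_Abij mul1g => e.
rewrite -[Y]invgK; apply/NV/e => i _; split.
- exact: P_Abij_G.
- exact: (@ambientX _ _ X Y).
- by rewrite mulgV.
- rewrite invg1 mulg1 /Bbij /=; case: odd => //.
  by rewrite multiplicativeV; apply: NV.
Qed.

(** If [Y] is killed, [RelG h] becomes the product of its elements of [G], which is [X h]. *)
Let killY N : normal_in P N -> N Y -> forall h, N (X h).
Proof.
move=> nN NY h; have [sN sub _] := nN; have [N1 NM NV] := sN.
have [->|h1] := eqVneq h 1; first by rewrite multiplicative1.
have v : valid zeta (RelG B h) by [].
have := altprod_congr (A := Abij (RelG B h)) (A' := fun=> 1)
  (B := Bbij (RelG B h)) (B' := Bbij (RelG B h)) (n := m) sP nN.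
rewrite relator_altprod // altprod_A1 gprod_Bbij mul1g => e.
rewrite -[X h]invgK; apply/NV/e => i _; split.
- exact: P_Abij_G.
- exact: (@ambientX _ _ X Y).
- rewrite invg1 mulg1 /Abij /=; case: ifP => _.
    by rewrite letter_bijV letter_bijX; apply: NV; apply: (subgroupX (M := N)).
  by rewrite letter_bijX; apply: (subgroupX (M := N)).
- by rewrite mulgV.
Qed.

(** If a power of [Z q] is killed, the corresponding relator [RelE] becomes the product of its
    elements of [G], which is trivial, and [Y^-1]. *)
Let killZ N : normal_in P N -> forall q k, Z q ^+ k <> 1 -> N (Z q ^+ k) -> N Y.
Proof.
move=> nN q k Zk Nk; have [[N1 NM NV] sub _] := nN; have [_ _ PV] := sP.
pose r := RelE G q (zeta q ^+ k).
have v : valid zeta r.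
  by apply/eqP => e; apply: Zk; rewrite /Z -letter_bijX e multiplicative1.
have := altprod_congr (A := Abij r) (A' := fun i => if i == 0%N then Y^-1 else 1)
  (B := Bbij r) (B' := Bbij r) (n := m) sP nN.
rewrite relator_altprod // -{2}(prednK m0) altprod_head prednK //.
rewrite /Bbij -gprodM cd multiplicative1 !mul1g invgK; apply => i _.
split; [|exact: (@ambientX _ _ X Y)| |by rewrite mulgV]; rewrite /Abij /=.
  case: ifP => _; last by rewrite letter_bijX; apply: sub.
  by rewrite letter_bijV; apply: PV; exact: (@ambientY _ _ X Y).
case: ifP => _; first by rewrite letter_bijV mulgV.
by rewrite letter_bijX invg1 mulg1.
Qed.

Theorem embedding : exists (S : groupType) (phi : {multiplicative G -> S}),
  [/\ is_simple S, injective phi & forall q, zeta q <> 1 -> exists z : S,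
    (forall k, z ^+ k = 1 <-> zeta q ^+ k = 1) /\
    generated_subgroup (range phi `|` [set z]) = [set: S]].
Proof.
have [S [phi [simp inj h]]] := simple_quotient Y1 PZ killX killY killZ genY.
exists S, phi; split=> // q zq; have /h [z [zk gen]] : Z q <> 1 by move=> /Z_eq1.
exists z; split=> // k; rewrite zk /Z -letter_bijX.
by split=> [/letter_bij_eq1 //|->]; rewrite multiplicative1.
Qed.

End Embedding.

Section ThreeElements.
Variable G : groupType.

Lemma two_nontrivial : `I_3 #<= [set: G] ->
  exists a b : G, [/\ a != 1, b != 1 & a != b].
Proof.
move=> /card_leP[f].
have mem i : (i < 3)%N -> i \in `I_3 by move=> lt; apply: mem_set.
pose g (i : 'I_3) : G := val (f (SigSub (mem i (ltn_ord i)))).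
have ne i j : i != j -> g i != g j.
  apply: contra => /eqP /val_inj e; apply/eqP/val_inj.
  by have /(congr1 val) := inj (f := f) (mem_set I) (mem_set I) e.
pose i0 : 'I_3 := ord0; pose i2 : 'I_3 := ord_max; pose i1 : 'I_3 := Ordinal (isT : (1 < 3)%N).
have [e0|n0] := eqVneq (g i0) 1.
  by exists (g i1), (g i2); rewrite -e0 !ne.
have [e1|n1] := eqVneq (g i1) 1.
  by exists (g i0), (g i2); rewrite -e1 !ne.
by exists (g i0), (g i1); rewrite !ne.
Qed.

(** The adjusted elements of [RelE]. *)
Lemma nontrivial_factors (a b e : G) : a != 1 -> b != 1 -> a != b ->
  exists c d, [/\ c != 1, d != 1 & d * (e * c) = 1].
Proof.
move=> a1 b1 ab.
(* [c] has to avoid [1] and [e^-1]; [a] or [b] does. *)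
suff [c c1 ec] : exists2 c, c != 1 & e * c != 1.
  by exists c, (e * c)^-1; rewrite invg_eq1 mulVg.
have [ea|] := eqVneq (e * a) 1; last by exists a.
by exists b => //; apply: contra ab => /eqP eb; apply/eqP/(mulgI e); rewrite ea eb.
Qed.

End ThreeElements.

Lemma gprod_RelE (G B : groupType) (a b c d : G) m bit q (t : B) : (1 < m)%N ->
  gprod (gletter a b c d m bit (RelE G q t)) m =
  d * (gprod (fun i => if i == 0%N then 1 else if bit i then a else b) m.-1 * c).
Proof.
case: m => [//|[//|n]] _; set f := gletter _ _ _ _ _ _ _.
rewrite -[LHS]/(f n.+1 * gprod f n.+1) gprod_head.
have -> : f n.+1 = d by rewrite /f /= eqxx.
congr (_ * (_ * _)); apply: eq_gprod => i lt.
by rewrite /f /= (ltn_eqF lt); case: eqP.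
Qed.

Unset Implicit Arguments.

Theorem corollaryB (G : groupType) (hG : `I_3 #<= [set: G]) :
  exists (S : groupType) (phi : {multiplicative G -> S}),
    [/\ is_simple S, injective phi &
      forall p : option nat, at_least_two p ->
        exists z : S, has_order z p /\
          generated_subgroup (range phi `|` [set z]) = [set: S]].
Proof.
have [a [b [a1 b1 ab]]] := two_nontrivial hG.
pose e := gprod (fun i => if i == 0%N then 1 else if pattern i then a else b)
  pattern_half.-1.
have [c [d [c1 d1 cd]]] := nontrivial_factors e a1 b1 ab.
have cd' (q : nat) (t : bijection (points G)) :
    gprod (gletter a b c d pattern_half pattern (RelE G q t)) pattern_half = 1.
  by rewrite gprod_RelE.
have [S [phi [simp inj h]]] := embedding (@cyclic_letter G)
  (m := pattern_half) (K := pattern_window) isT isT isT (@translate_inj G)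
  (@stable_letter_inf G) a1 b1 c1 d1 ab pattern_aperiodic cd'.
exists S, phi; split=> // -[p|] /= p2.
  have p0 : (0 < p)%N := ltnW p2.
  have cp := cyclic_letterX_eq1 G.
  have zp : cyclic_letter G p <> 1.
    by move=> e1; have /(cp _ 1%N p0) := e1; rewrite dvdn1; lia.
  have [z [zk gen]] := h p zp; exists z; split=> //; split=> // [|k /andP[k0 kp]].
    exact/zk/cp.
  by move=> /zk /(cp _ _ p0) /dvdn_leq; lia.
have z0 : cyclic_letter G 0 <> 1 by move=> /(@stable_letter_inf G 1).
have [z [zk gen]] := h 0%N z0; exists z; split=> // k k0 /zk /(@stable_letter_inf G).
by lia.
Qed.
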